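(* Assume that $\omega_k>0$ and $K_{km}>0$ (for all $k,m\in V$); then the selection probabilities $p_m^{(n)}$ of the random source iteration (RSI) are strictly positive. Let $$\mathcal{M}_m^{(n)}=\mathbb{E}\left[\frac12\int_{\mathcal{D}}\Sigma_T\sum_{g=1}^G\sum_{k\in V_g}\sum_{k'\in V_g}\left(\sqrt{\frac{p_{k'}^{(n)}}{p_k^{(n)}}}\,\omega_kK_{km}\tilde\psi_k^{(n)}-\sqrt{\frac{p_k^{(n)}}{p_{k'}^{(n)}}}\,\omega_{k'}K_{k'm}\tilde\psi_{k'}^{(n)}\right)^2d\boldsymbol r\right],$$ and $\mathcal{M}=\max_{m,n}\{\mathcal{M}_m^{(n)}\}$. Then for any $n$, the variances $$\mathbb{E}\left[\sum_{m\in V}\omega_m\left\|\sqrt{\Sigma_T}\big(\tilde\psi_m^{(n)}-\psi_m^{(n)}\big)\right\|_2^2\right]\quad\text{and}\quad\mathbb{E}\left[\sum_{m\in V}\omega_m\left\|\sqrt{\Sigma_T}\big(\tilde\phi_m^{(n)}-\phi_m^{(n)}\big)\right\|_2^2\right]$$ are bounded by $$\left\|\frac{\Sigma_S}{\Sigma_T}\right\|_\infty^{2n}V_0+\frac{1-\left\|\frac{\Sigma_S}{\Sigma_T}\right\|_\infty^{2n}}{1-\left\|\frac{\Sigma_S}{\Sigma_T}\right\|_\infty^{2}}\,\mathcal{M},\qquad V_0=\mathbb{E}\left[\sum_{m\in V}\omega_m\left\|\sqrt{\Sigma_T}\big(\tilde\phi_m^{(0)}-\phi_m^{(0)}\big)\right\|_2^2\right],$$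 and hence are uniformly bounded with respect to $n$.
   Context: Setting. $\mathcal{D}\subset\mathbb{R}^3$ is a bounded convex domain with outward normal $\boldsymbol n_{\boldsymbol r}$ at $\boldsymbol r\in\partial\mathcal{D}$; $\|u\|_2=(\int_{\mathcal{D}}u^2\,d\boldsymbol r)^{1/2}$ and $\|\cdot\|_\infty$ is the sup norm on $\mathcal{D}$. $\Sigma_T$, $\Sigma_S$, $Q$ are given (deterministic) functions on $\mathcal{D}$: the total cross-section, the scattering cross-section and the source; it is a standing requirement that $\Sigma_S<\Sigma_T$ uniformly in space, i.e. $\|\Sigma_S/\Sigma_T\|_\infty<1$. $\psi_\Gamma^-$ is given deterministic inflow boundary data. $V=\{1,\dots,M\}$ indexes discrete ordinates $\Omega_m\in\mathbb{S}^2$ with weights $\omega_m$, and $K_{km}$ ($k,m\in V$) is a discrete scattering kernel with $\sum_{k\in V}\omega_kK_{km}=1$ for all $m$, $\sum_{m\in V}\omega_mK_{km}=1$ for all $k$, and $\sum_{m\in V}\omega_m=1$. Source iteration (SI). Given initial functions $\psi_m^{(0)}$ ($m\in V$), put $\phi_m^{(0)}=\sum_{k\in V}\omega_kK_{km}\psi_k^{(0)}$. For $n\ge1$ and $m\in V$, $\psi_m^{(n)}$ is the solution of $$\Omega_m\cdot\nabla\psi_m^{(n)}+\Sigma_T\psi_m^{(n)}=\Sigma_S\phi_m^{(n-1)}+Q\ \text{ in }\mathcal{D},\qquad \psi_m^{(n)}=\psi_\Gamma^-(\cdot,\Omega_m)\ \text{ on }\{\boldsymbol r\in\partial\mathcal{D}:\Omega_m\cdot\boldsymbol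 n_{\boldsymbol r}<0\},$$ and $\phi_m^{(n)}=\sum_{k\in V}\omega_kK_{km}\psi_k^{(n)}$. Random source iteration (RSI). $V$ is partitioned into $G$ groups $V_1,\dots,V_G$; $V(k)$ is the group containing $k$. The random set $V^{(0)}$ consists of one index chosen with uniform probability from each group. Set $\tilde\psi_m^{(0)}=\psi_m^{(0)}$ (only indices in $V^{(0)}$ are used) and $\tilde\phi_m^{(0)}=\sum_{k\in V^{(0)}}\omega_kK_{km}|V(k)|\tilde\psi_k^{(0)}$. For $n\ge1$, put $c_m^{(n-1)}=\sum_{k\in V^{(n-1)}}\omega_kK_{km}$ and $$p_m^{(n)}=\frac{\omega_mc_m^{(n-1)}}{\sum_{m'\in V(m)}\omega_{m'}c_{m'}^{(n-1)}};$$ given $V^{(n-1)}$, the set $V^{(n)}$ consists of one index from each group, chosen independently across groups, index $m$ being chosen from its group with probability $p_m^{(n)}$. For all $m\in V$, $\tilde\psi_m^{(n)}$ is the solution of the same transport problem as in SI with $\phi_m^{(n-1)}$ replaced by $\tilde\phi_m^{(n-1)}$, and $$\tilde\phi_m^{(n)}=\sum_{k\in V^{(n)}}\omega_kK_{km}\frac{1}{p_k^{(n)}}\tilde\psi_k^{(n)}.$$ *)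

(* Defs.v *)
From HB Require Import structures.
From mathcomp Require Import all_boot all_order all_algebra.
From mathcomp Require Import all_classical all_reals all_analysis.

Set Implicit Arguments.
Unset Strict Implicit.
Unset Printing Implicit Defensive.

Import Order.TTheory GRing.Theory Num.Theory.
Import numFieldNormedType.Exports.

Local Open Scope classical_set_scope.
Local Open Scope ring_scope.

Notation point3 R := (R * R * R)%type.

Section Geometry.
Context {R : realType}.

Definition leb3 :=
  ((@lebesgue_measure R \x @lebesgue_measure R) \x @lebesgue_measure R)%E.

Definition dot (u v : point3 R) : R :=
  u.1.1 * v.1.1 + u.1.2 * v.1.2 + u.2 * v.2.

Definition boundary (D : set (point3 R)) : set (point3 R) :=
  closure D `\` interior D.

Definition bounded_convex_domain (D : set (point3 R)) : Prop :=
  [/\ D !=set0, open D, bounded_set D & convex_set D].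

(* A convex domain may have edges and corners, where the outward normal is not
   unique: [nv] is then any unit vector of the normal cone. *)
Definition outward_normal (D : set (point3 R)) (nv : point3 R -> point3 R) : Prop :=
  forall r, boundary D r ->
    dot (nv r) (nv r) = 1 /\ (forall x, D x -> dot (nv r) (x - r) <= 0).

(* Extended-real valued: +oo when [u] is not square integrable. *)
Definition l2norm (D : set (point3 R)) (u : point3 R -> R) : \bar R :=
  sqrte (\int[leb3]_(r in D) ((u r) ^+ 2)%:E)%E.

Definition supnorm (D : set (point3 R)) (u : point3 R -> R) : \bar R :=
  ereal_sup [set `|u r|%:E | r in D].

End Geometry.

Section Transport.
Context {R : realType}.

(* Absolute continuity on [a, b]; the finite family of non-overlapping
   subintervals is the list [s] of pairs of end points, from left to right. *)
Definition abs_continuous (a b : R) (f : R -> R) : Prop :=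
  forall e : R, 0 < e -> exists2 d : R, 0 < d &
    forall s : seq (R * R),
      all (fun p => [&& a <= p.1, p.1 <= p.2 & p.2 <= b]) s ->
      pairwise (fun p q => p.2 <= q.1) s ->
      \sum_(p <- s) (p.2 - p.1) < d ->
      \sum_(p <- s) `|f p.2 - f p.1| < e.

(* [psi] solves Om . grad psi + SigT psi = q in D with psi = g on the inflow
   boundary, in the usual sense of transport theory: the streaming term
   Om . grad psi is the derivative of [psi] in the direction [Om], the equation
   holds almost everywhere in D (the coefficients may be discontinuous), and
   [psi] is absolutely continuous along almost every characteristic, up to the
   boundary. *)
Record transport_solution (D : set (point3 R)) (nv : point3 R -> point3 R)
    (Om : point3 R) (SigT q g psi : point3 R -> R) : Prop := TransportSolution {
  ts_measurable : measurable_fun D psi ;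
  ts_abs_continuous : {ae leb3, forall r, D r ->
    forall a b : R, a < b ->
      (forall u, a < u < b -> D (r + u *: Om)) ->
      abs_continuous a b (fun u => psi (r + u *: Om))} ;
  ts_equation : {ae leb3, forall r, D r ->
    derivable psi r Om /\ 'D_Om psi r + SigT r * psi r = q r} ;
  ts_inflow : forall r, boundary D r -> dot Om (nv r) < 0 -> psi r = g r }.

End Transport.

Section Iterations.
Context {R : realType} {M : nat}.
Variables (D : set (point3 R)) (nv : point3 R -> point3 R).
Variables (Om : 'I_M -> point3 R) (w : 'I_M -> R) (K : 'I_M -> 'I_M -> R).
Variables (SigT SigS Q : point3 R -> R) (psiG : point3 R -> point3 R -> R).

Definition transport_problem (m : 'I_M) (f : point3 R -> R)
    (u : point3 R -> R) : Prop :=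
  transport_solution D nv (Om m) SigT (fun r => SigS r * f r + Q r)
    (fun r => psiG r (Om m)) u.

Definition si_phi (psi : nat -> 'I_M -> point3 R -> R)
    (n : nat) (m : 'I_M) (r : point3 R) : R :=
  \sum_(k < M) w k * K k m * psi n k r.

Definition source_iteration (psi : nat -> 'I_M -> point3 R -> R) : Prop :=
  forall n m, transport_problem m (si_phi psi n m) (psi n.+1 m).

(* The groups are the blocks of a partition [P] of the index set; V(k) is
   [finset.pblock P k]. *)
Variable P : {set {set 'I_M}}.

Definition rsi_c (A : {set 'I_M}) (m : 'I_M) : R :=
  \sum_(k in A) w k * K k m.

Definition rsi_prob (A : {set 'I_M}) (m : 'I_M) : R :=
  w m * rsi_c A m / \sum_(m' in finset.pblock P m) w m' * rsi_c A m'.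

Context {d : measure_display} {T : measurableType d}.
Variables (Pr : probability T R) (V : nat -> T -> {set 'I_M}).

(* p_m^(n), meaningful for n >= 1 only *)
Definition rsi_p (n : nat) (t : T) (m : 'I_M) : R := rsi_prob (V n.-1 t) m.

(* [sel_step] gives the law of V^(n+1) given the whole history V^(0..n): it
   depends on V^(n) only, and the choices are independent across groups. *)
Record rsi_selection : Prop := RsiSelection {
  sel_measurable : forall n A, measurable [set t | V n t = A] ;
  sel_transversal : forall n t, finset.is_transversal (V n t) P [set: 'I_M]%SET ;
  sel_init : forall A, finset.is_transversal A P [set: 'I_M]%SET ->
    Pr [set t | V 0 t = A] = (\prod_(k in A) (#|finset.pblock P k|%:R^-1 : R))%:E ;
  sel_step : forall n (h : nat -> {set 'I_M}),
    (forall i, finset.is_transversal (h i) P [set: 'I_M]%SET) ->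
    Pr [set t | forall i, (i <= n.+1)%N -> V i t = h i] =
    (Pr [set t | forall i, (i <= n)%N -> V i t = h i] *
     (\prod_(k in h n.+1) rsi_prob (h n) k)%:E)%E }.

Definition rsi_phi (psit : nat -> T -> 'I_M -> point3 R -> R)
    (n : nat) (t : T) (m : 'I_M) (r : point3 R) : R :=
  if n is 0 then
    \sum_(k in V 0 t) w k * K k m * #|finset.pblock P k|%:R * psit 0 t k r
  else
    \sum_(k in V n t) w k * K k m * (rsi_p n t k)^-1 * psit n t k r.

Record random_source_iteration (psi0 : 'I_M -> point3 R -> R)
    (psit : nat -> T -> 'I_M -> point3 R -> R) : Prop := RandomSourceIteration {
  rsi_init : forall t m r, psit 0 t m r = psi0 m r ;
  rsi_step : forall n t m,
    transport_problem m (rsi_phi psit n t m) (psit n.+1 t m) }.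

Variable psi : nat -> 'I_M -> point3 R -> R.
Variable psit : nat -> T -> 'I_M -> point3 R -> R.

(* The expectations below are integrals of nonnegative extended-real valued
   functions, and so are always meaningful. *)
Definition psi_variance (n : nat) : \bar R :=
  (\int[Pr]_t \sum_(m < M) (w m)%:E *
     l2norm D (fun r =>
       Num.sqrt (SigT r) * (psit n t m r - psi n m r))%R ^+ 2)%E.

Definition phi_variance (n : nat) : \bar R :=
  (\int[Pr]_t \sum_(m < M) (w m)%:E *
     l2norm D (fun r =>
       Num.sqrt (SigT r) * (rsi_phi psit n t m r - si_phi psi n m r))%R ^+ 2)%E.

Definition rsi_M (n : nat) (m : 'I_M) : \bar R :=
  (\int[Pr]_t ((2^-1 : R)%:E * \int[leb3]_(r in D)
    (SigT r * \sum_(g in P) \sum_(k in g) \sum_(k' in g)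
       (Num.sqrt (rsi_p n t k' / rsi_p n t k) * (w k * K k m * psit n t k r)
        - Num.sqrt (rsi_p n t k / rsi_p n t k') *
            (w k' * K k' m * psit n t k' r)) ^+ 2)%R%:E))%E.

Definition rsi_Mmax : \bar R :=
  ereal_sup [set x | exists n m, (1 <= n)%N /\ x = rsi_M n m].

End Iterations.

(* Main.v *)
(* The transport solution operator contracts the [SigT]-weighted energy: along
   almost every line of direction [Om], the difference [E] of two solutions has zero
   inflow and satisfies [(E^2)' + SigT E^2 <= (SigS f)^2 / SigT], [f] being the
   difference of the scattering terms; integration over all lines gives
   [int SigT E^2 <= rho^2 int SigT f^2], that is, var_psi(n+1) <= rho^2 var_phi(n).
   Conditionally on the past, the sampled scattering term at step [n+1] is unbiased,
   and its variance is the quantity averaged in [M_m^(n+1)], because the choices in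
   distinct groups are independent; Jensen's inequality and the normalisation of [K]
   bound the squared bias by the error of [psi], whence
   var_phi(n+1) <= var_psi(n+1) + M. The bound is the sum of the resulting
   geometric series. *)
Require Import Defs.
From HB Require Import structures.
From mathcomp Require Import all_boot all_order all_algebra.
From mathcomp Require Import all_classical all_reals all_analysis.
From mathcomp Require Import measurable_realfun ring lra.

Set Implicit Arguments.
Unset Strict Implicit.
Unset Printing Implicit Defensive.

Import Order.TTheory GRing.Theory Num.Theory.
Import numFieldNormedType.Exports.

Local Open Scope classical_set_scope.
Local Open Scope ring_scope.

(** * Absolutely continuous functions and the energy inequality on a line *)

Section AbsContinuous.
Context {R : realType}.
Implicit Types (a b : R) (f g : R -> R).

(** Along a line nothing guarantees that [SigT E^2] is integrable, so [(E^2)'] is not integrated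
    directly: [E^2] is compared with the primitive of an integrable function by a monotonicity
    criterion for absolutely continuous functions. In space, almost every starting point gives a
    good line, although the lines through different points overlap; a translation argument replaces
    a change of coordinates. On the probabilistic side, the iterates are arbitrary functions of the
    sample point, so measurability of the errors has to be earned: each error depends only on the
    finitely many selections made so far, and conditional expectations become finite sums over
    histories. Variances may be infinite; the recursion therefore runs in the extended reals, and
    finiteness enters only with the uniform bound, where that of the initial variance comes from the
    square-integrable initial functions. *)

Lemma abs_continuous_small a b f : abs_continuous a b f ->
  forall e, 0 < e -> exists2 d, 0 < d &
    forall x y, a <= x -> x <= y -> y <= b -> y - x < d -> `|f y - f x| < e.
Proof.
move=> fac e e0; have [d d0 fd] := fac e e0.
exists d => // x y ax xy yb xyd.
have := fd [:: (x, y)]; rewrite !big_seq1/= ax xy yb/=.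
by apply.
Qed.

(** Over a step of length [d / 2] the function moves by less than 1, and finitely many such steps
    lead from [a] to any point of the interval. *)
Lemma abs_continuous_bounded a b f : abs_continuous a b f ->
  exists2 C, 0 < C & forall x, a <= x -> x <= b -> `|f x| <= C.
Proof.
move=> /abs_continuous_small/(_ 1 ltr01)[d d0 fd].
have step (n : nat) x : a <= x -> x <= b -> x - a <= n%:R * (d / 2) ->
    `|f x - f a| <= n%:R.
  elim: n x => [|n IH] x ax xb.
    rewrite mul0r subr_le0 => xa.
    have -> : x = a by apply/eqP; rewrite eq_le xa ax.
    by rewrite subrr normr0.
  move=> xan; pose y := Num.max a (x - d / 2).
  have ay : a <= y by rewrite le_max lexx.
  have yx : y <= x by rewrite ge_max ax/= lerBlDr lerDl divr_ge0 ?ltW.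
  have yan : y - a <= n%:R * (d / 2).
    rewrite lerBlDr ge_max; apply/andP; split.
      by rewrite lerDr mulr_ge0// divr_ge0// ltW.
    by move: xan; rewrite -natr1; lra.
  have xyd : x - y < d.
    have : x - d / 2 <= y by rewrite le_max lexx orbT.
    by lra.
  have -> : f x - f a = (f x - f y) + (f y - f a) by ring.
  rewrite (le_trans (ler_normD _ _))// -natr1 addrC lerD//.
    exact: (IH _ ay (le_trans yx xb) yan).
  exact/ltW/fd.
have [n hn] : exists n : nat, b - a <= n%:R * (d / 2).
  exists (Num.Def.archi_bound `|(b - a) / (d / 2)|).
  rewrite -ler_pdivrMr ?divr_gt0//.
  exact: le_trans (ler_norm _) (ltW (archi_boundP (normr_ge0 _))).
exists (`|f a| + n%:R + 1) => [|x ax xb].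
  by rewrite ltr_wpDl// addr_ge0.
have -> : f x = f a + (f x - f a) by ring.
rewrite (le_trans (ler_normD _ _))// -addrA lerD2l//.
rewrite (@le_trans _ _ n%:R) ?lerDl//; apply: step => //.
by rewrite (le_trans _ hn)// lerB.
Qed.

Lemma abs_continuousB a b f g : abs_continuous a b f -> abs_continuous a b g ->
  abs_continuous a b (fun x => f x - g x).
Proof.
move=> fac gac e e0.
have e20 : 0 < e / 2 by rewrite divr_gt0.
have [d1 d10 fd] := fac _ e20; have [d2 d20 gd] := gac _ e20.
exists (Num.min d1 d2); first by rewrite lt_min d10.
move=> s s1 s2; rewrite lt_min => /andP[s3 s4].
rewrite (@le_lt_trans _ _ (\sum_(p <- s) `|f p.2 - f p.1| +
                           \sum_(p <- s) `|g p.2 - g p.1|))//.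
  rewrite -big_split/=; apply: ler_sum => p _.
  have -> : f p.2 - g p.2 - (f p.1 - g p.1) =
    (f p.2 - f p.1) - (g p.2 - g p.1) by ring.
  exact: ler_normB.
by rewrite [ltRHS](splitr e) ltrD ?fd ?gd.
Qed.

(** With [C] a bound for [|f|], the increments of the square are at most [2 * C] times those of
    [f]. *)
Lemma abs_continuous_sqr a b f : abs_continuous a b f ->
  abs_continuous a b (fun x => f x ^+ 2).
Proof.
move=> fac e e0; have [C C0 fC] := abs_continuous_bounded fac.
have [d d0 fd] := fac (e / (2 * C)) (divr_gt0 e0 (mulr_gt0 (ltr0n _ 2) C0)).
exists d => // s s1 s2 s3; have := fd s s1 s2 s3.
rewrite ltr_pdivlMr ?mulr_gt0//; apply: le_lt_trans.
rewrite mulr_suml big_seq [leRHS]big_seq; apply: ler_sum => p ps.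
have /and3P[ap pp pb] := allP s1 _ ps.
rewrite subr_sqr normrM ler_wpM2l// (le_trans (ler_normD _ _))//.
rewrite mulr2n mulrDl mul1r lerD// fC//.
  exact: le_trans pp.
exact: le_trans pb.
Qed.

Notation mu := (@lebesgue_measure R).

(* Every point of the open set [U] contributes through the total length of the
   chosen intervals, every other point through the sign of its derivative; the
   supremum of the points up to which such a choice exists is [b]. *)
Lemma abs_continuous_nonincreasing a b f : a <= b -> abs_continuous a b f ->
  {ae mu, forall x, a < x < b -> derivable f x 1 /\ derive1 f x <= 0} ->
  f b <= f a.
Proof.
move=> ab fac [N [mN N0 fN]].
(* The slope [e] pays for the points where the derivative is nonpositive, the slack [e] for the
   exceptional ones. *)
suff main e : 0 < e -> f b - f a <= e * (b - a) + e.
  rewrite -subr_le0; apply/ler_addgt0Pr => e e0; rewrite add0r.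
  have k0 : 0 < b - a + 1 by rewrite ltr_wpDl// subr_ge0.
  have := main (e / (b - a + 1)) (divr_gt0 e0 k0).
  suff -> : e / (b - a + 1) * (b - a) + e / (b - a + 1) = e by [].
  by field; rewrite gt_eqF.
move=> e0; have [d d0 fd] := fac e e0.
(* The derivative is controlled only strictly inside the interval, so the end points count as
   exceptional. *)
pose N' := N `|` [set a; b].
have mN' : measurable N' by apply: measurableU => //; apply: measurableU.
have N'0 : mu N' = 0%E.
  rewrite measureU0//.
    exact: measurableU.
  by rewrite measureU0 ?lebesgue_measure_set1//; apply: lebesgue_measure_set1.
(* Non-overlapping intervals of total length at most [mu U < d] carry a variation of [f] below
   [e]. *)
have [U [oU NU Ud]] : exists U : set R, [/\ open U, N' `<=` U & (mu U < d%:E)%E].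
  have [|U [oU NU Ud]] := @lebesgue_regularity_outer _ N' d mN' _ d0.
    by move: N'0; rewrite /= => ->.
  exists U; split => //; rewrite -(setDUK NU).
  rewrite (le_lt_trans (measureU2 _ _ _))//.
    by apply: measurableD => //; exact: open_measurable.
  by move: N'0; rewrite /= => ->; rewrite add0e.
have mU : measurable U by exact: open_measurable.
(* The length is measured against the part of [U] up to [x] only, so that an interval of [U] can be
   appended on the right of [x]. *)
pose good x := [/\ a <= x, x <= b & exists s : seq (R * R),
  [/\ all (fun p => [&& a <= p.1, p.1 <= p.2 & p.2 <= x]) s,
     pairwise (fun p q => p.2 <= q.1) s,
     ((\sum_(p <- s) (p.2 - p.1))%:E <= mu (U `&` `[a, x]))%E &
     f x - f a <= e * (x - a) + \sum_(p <- s) `|f p.2 - f p.1|]].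
have good_a : good a.
  split => //; exists [::]; split => //; rewrite !big_nil ?measure_ge0//.
  by rewrite !subrr mulr0 addr0.
have good_slope x y : good x -> x <= y -> y <= b ->
    f y - f x <= e * (y - x) -> good y.
  move=> [ax xb [s [s1 s2 s3 s4]]] xy yb fxy; split => //.
    exact: le_trans xy.
  exists s; split => //.
  - by apply: sub_all s1 => p /and3P[-> -> /le_trans]; apply.
  - rewrite (le_trans s3)// le_measure ?inE//; try exact: measurableI.
    by apply: setIS => z /=; rewrite !in_itv/= => /andP[-> /le_trans]; apply.
  - have -> : f y - f a = (f y - f x) + (f x - f a) by ring.
    have -> : e * (y - a) = e * (y - x) + e * (x - a) by ring.
    by rewrite -[leRHS]addrA lerD.
have good_open x y : good x -> x <= y -> y <= b -> `[x, y] `<=` U -> good y.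
  move=> [ax xb [s [s1 s2 s3 s4]]] xy yb xyU; split => //.
    exact: le_trans xy.
  exists (rcons s (x, y)); split.
  - rewrite all_rcons/= ax xy lexx/=.
    by apply: sub_all s1 => p /and3P[-> -> /le_trans]; apply.
  - rewrite pairwise_rcons s2 andbT.
    by apply: sub_all s1 => p /and3P[_ _].
  - rewrite -cats1 big_cat/= big_seq1/= EFinD.
    rewrite (@le_trans _ _ (mu (U `&` `[a, x]) + mu `]x, y])%E)//.
      by rewrite leeD// lebesgue_measure_itv/= lte_fin; case: ltgtP xy => //= ->;
        rewrite subrr.
    rewrite -measureU//; last 2 first.
    + exact: measurableI.
    + apply/seteqP; split => // z /= [[_]]; rewrite !in_itv/=.
      by move=> /andP[_ zx] /andP[xz _]; have := lt_le_trans xz zx; rewrite ltxx.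
    + rewrite le_measure ?inE//.
      * by apply: measurableU => //; exact: measurableI.
      * exact: measurableI.
      * move=> z /= [[Uz]|]; rewrite !in_itv/=.
          by move=> /andP[-> /le_trans zy]; split => //; exact: zy.
        move=> /andP[xz zy]; split; last by rewrite (le_trans ax (ltW xz)).
        by apply: xyU; rewrite /= in_itv/= (ltW xz).
  - rewrite -cats1 big_cat/= big_seq1/=.
    have -> : f y - f a = (f x - f a) + (f y - f x) by ring.
    rewrite [leRHS]addrA lerD ?ler_norm// (le_trans s4)// lerD2r.
    by rewrite ler_pM2l// lerD2r.
have good_b : good b.
  pose c := sup good.
  have sup_good : has_sup good by split; [exists a | exists b => x []].
  have ac : a <= c by apply: ub_le_sup => //; exists b => x [].
  have cb : c <= b by apply: ge_sup; [exists a|move=> x []].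
  (* Goodness passes from just left of [c] to just right of it: by one interval if [c] lies in [U],
     otherwise by two moves through [c], each controlled by the difference quotients at [c]. *)
  have [eta eta0 step] : exists2 eta : R, 0 < eta &
      forall y z, c - eta < y -> y <= c -> c <= z -> z < c + eta -> z <= b ->
        good y -> good z.
    have [cU|cU] := pselect (U c).
      have [eta/= eta0 etaU] := oU _ cU.
      exists eta => // y z ey yc cz ze zb /good_open; apply => //.
        exact: le_trans cz.
      move=> x /=; rewrite in_itv/= => /andP[yx xz]; apply: etaU.
      rewrite /= ltr_distlC; apply/andP; split; first exact: lt_le_trans yx.
      exact: le_lt_trans ze.
    have cN : ~ N' c by move=> /NU.
    have acb : a < c < b.
      rewrite !lt_neqAle ac cb !andbT; apply/andP; split; apply/eqP => ca.
        by apply: cN; right; left.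
      by apply: cN; right; right.
    have [fc fc0] : derivable f c 1 /\ derive1 f c <= 0.
      by apply: contrapT => H; apply: cN; left; apply: fN => /= /(_ acb).
    have : (fun h => h^-1 *: (f (h *: (1 : R) + c) - f c)) @ 0^' --> derive1 f c.
      by rewrite derive1E; exact: fc.
    move=> /cvgrPdist_lt/(_ _ e0)[eta/= eta0 Heta].
    have slope h : h != 0 -> `|h| < eta -> (f (h + c) - f c) / h <= e.
      move=> h0 he; have := Heta h; rewrite /ball_/= sub0r normrN => /(_ he h0).
      rewrite [h *: 1]mulr1 /GRing.scale/= mulrC ltr_distlC => /andP[_ /ltW/le_trans]; apply.
      by rewrite -[leRHS]add0r lerD.
    exists eta => // y z ey yc cz ze zb goody.
    have goodc : good c.
      apply: (good_slope y) => //; have [->|yc'] := eqVneq y c.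
        by rewrite !subrr mulr0.
      have yltc : y - c < 0 by rewrite subr_lt0 lt_neqAle yc'.
      have := slope (y - c); rewrite subrK lt_eqF// ltr0_norm// => /(_ isT).
      rewrite ler_ndivrMr//; lra.
    apply: (good_slope c) => //; have [->|zc'] := eqVneq z c.
      by rewrite !subrr mulr0.
    have cltz : 0 < z - c by rewrite subr_gt0 lt_neqAle eq_sym zc'.
    have := slope (z - c); rewrite subrK gt_eqF// gtr0_norm// => /(_ isT).
    rewrite ler_pdivrMr//; lra.
  have [y goody cy] := sup_adherent eta0 sup_good.
  have yc : y <= c by apply: ub_le_sup => //; case: sup_good.
  (* [z] is good, hence at most [c]; this leaves only [z = b]. *)
  pose z := Num.min b (c + eta / 2).
  have cz : c <= z by rewrite le_min cb lerDl divr_ge0// ltW.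
  have goodz : good z.
    apply: (step y z) => //.
      by rewrite (@le_lt_trans _ _ (c + eta / 2)) ?ge_min ?lexx ?orbT//; lra.
    by rewrite ge_min lexx.
  have zc : z <= c by apply: ub_le_sup => //; case: sup_good.
  have <- // : z = b.
  move: zc; rewrite {1}/z ge_min => /orP[bc|]; last by lra.
  by apply/eqP; rewrite eq_le ge_min lexx/= (le_trans bc).
case: good_b => _ _ [s [s1 s2 s3 s4]].
rewrite (le_trans s4)// lerD2l ltW//; apply: fd => //.
rewrite -lte_fin (le_lt_trans s3)// (le_lt_trans _ Ud)//.
by rewrite le_measure ?inE//; exact: measurableI.
Qed.

(** Based at [-oo] to fit the almost everywhere differentiation theorem; only its increments
    matter. *)
Definition primitiveNy (g : R -> R) (x : R) : R := (\int[mu]_(t in `]-oo, x]) g t)%R.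

Lemma primitiveNyB g x y : mu.-integrable setT (EFin \o g) -> x <= y ->
  primitiveNy g y - primitiveNy g x = (\int[mu]_(t in `]x, y]) g t)%R.
Proof.
move=> ig xy; rewrite /primitiveNy Rintegral_itvB// ?bnd_simp//.
by apply: integrableS ig.
Qed.

(** The increments are bounded by the integral of [|g|] over the union of the intervals, which is
    small with the measure of that union. *)
Lemma abs_continuous_primitiveNy a b g : mu.-integrable setT (EFin \o g) ->
  abs_continuous a b (primitiveNy g).
Proof.
move=> ig e e0; have [d [d0 gd]] := integral_normr_continuous ig e0.
exists d => // s s1 s2 sd.
suff [A [mA As Ai]] : exists A : set R, [/\ measurable A,
    (mu A <= (\sum_(p <- s) (p.2 - p.1))%:E)%E &
    \sum_(p <- s) `|primitiveNy g p.2 - primitiveNy g p.1| <=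
      (\int[mu]_(x in A) `|g x|)%R].
  rewrite (le_lt_trans Ai)// gd// (le_lt_trans As)//.
have igabs A : measurable A -> mu.-integrable A (EFin \o (fun x => `|g x|)).
  move=> mA; apply: integrableS (integrable_norm ig) => //.
(* The added clause serves the induction: every point of [A] lies to the right of some left end
   point, so an interval put in front is disjoint from [A]. *)
suff [A [mA As Ai _]] : exists A : set R, [/\ measurable A,
    (mu A <= (\sum_(p <- s) (p.2 - p.1))%:E)%E,
    \sum_(p <- s) `|primitiveNy g p.2 - primitiveNy g p.1| <=
      (\int[mu]_(x in A) `|g x|)%R &
    forall x, A x -> exists2 p, p \in s & p.1 < x] by exists A.
elim: s s1 s2 {sd} => [|[p q] s IH] /=.
  move=> _ _; exists set0; split => //; rewrite !big_nil ?measure0//.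
  by rewrite Rintegral_set0.
move=> /andP[/and3P[ap pq qb] s1] /andP[s2 s3].
have [A [mA As Ai As1]] := IH s1 s3.
have dis : [disjoint `]p, q]%classic & A].
  apply/eqP/seteqP; split => // z [/=]; rewrite in_itv/= => /andP[_ zq].
  move=> /As1[r /(allP s2)/= qr rz].
  by have := lt_le_trans rz (le_trans zq qr); rewrite ltxx.
exists (`]p, q]%classic `|` A); split.
- exact: measurableU.
- rewrite big_cons/= (le_trans (measureU2 _ _ _))// EFinD leeD//.
  have <- : (mu `]p, q] = (q - p)%:E)%E; last exact: lexx.
  rewrite lebesgue_measure_itv/= lte_fin; case: ltgtP pq => //= ->.
  by rewrite subrr.
- rewrite big_cons/= Rintegral_setU//; last exact/igabs/measurableU.
  rewrite lerD// primitiveNyB// le_normr_Rintegral//.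
  exact: integrableS ig.
- move=> x [|/As1[r rs rx]].
    by rewrite /= in_itv/= => /andP[px _]; exists (p, q); rewrite ?mem_head.
  by exists r; rewrite // inE rs orbT.
Qed.

(* Integrate [(E^2)' + sig E^2 <= G] over [[a, b]]; since [sig E^2] is not known
   to be integrable, it is first truncated at height [n]. *)
Lemma energy_inequality_1d a b (E sig G : R -> R) : a <= b ->
  abs_continuous a b E -> E a = 0 ->
  measurable_fun `]a, b[ (fun x => sig x * E x ^+ 2) ->
  measurable_fun `]a, b[ G ->
  (forall x, `]a, b[%classic x -> 0 <= sig x /\ 0 <= G x) ->
  {ae mu, forall x, a < x < b ->
    derivable E x 1 /\ 2 * E x * derive1 E x + sig x * E x ^+ 2 <= G x} ->
  (\int[mu]_(x in `]a, b[) (sig x * E x ^+ 2)%:E <= \int[mu]_(x in `]a, b[) (G x)%:E)%E.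
Proof.
move=> ab Eac Ea mu_ mG sG0 HE.
set u := fun x => sig x * E x ^+ 2 in mu_ *.
have u0 x : `]a, b[%classic x -> 0 <= u x.
  by move=> /sG0[s0 _]; rewrite mulr_ge0// sqr_ge0.
have G0 x : `]a, b[%classic x -> 0 <= G x by move=> /sG0[].
(* An infinite right-hand side leaves nothing to prove; otherwise [G] is integrable. *)
have [->|Gfin] := eqVneq (\int[mu]_(x in `]a, b[) (G x)%:E)%E +oo%E.
  by rewrite leey.
have iG : mu.-integrable `]a, b[ (EFin \o G).
  apply/integrableP; split; first exact/measurable_EFinP.
  under eq_integral => x xab.
    rewrite inE in xab; rewrite /= (@ger0_norm _ (G x)) ?G0//. over.
  by rewrite ltey.
pose un n x := Num.min (u x) n%:R.
have mun n : measurable_fun `]a, b[ (un n) by apply: measurable_minr.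
have un0 n x : `]a, b[%classic x -> 0 <= un n x.
  by move=> /u0 ux; rewrite le_min ux/=.
have fin_ab : (mu `]a, b[ < +oo)%E.
  by rewrite lebesgue_measure_itv/=; case: ifP => _; rewrite ?ltry.
have iun n : mu.-integrable `]a, b[ (EFin \o un n).
  apply: measurable_bounded_integrable => //; first exact: mun.
  exists n%:R; split => // r nr x xab; rewrite /= ger0_norm ?un0//.
  by rewrite (le_trans _ (ltW nr))// ge_min lexx orbT.
suff main n : (\int[mu]_(x in `]a, b[) (un n x)%:E <= \int[mu]_(x in `]a, b[) (G x)%:E)%E.
  have cvgun : (fun n => \int[mu]_(x in `]a, b[) (un n x)%:E)%E @ \oo -->
      (\int[mu]_(x in `]a, b[) (u x)%:E)%E.
    have -> : (\int[mu]_(x in `]a, b[) (u x)%:E =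
        \int[mu]_(x in `]a, b[) (limn (fun n => (un n x)%:E)))%E.
      apply: eq_integral => x _; apply/esym/cvg_lim => //.
      apply: cvg_near_cst; exists (Num.Def.archi_bound `|u x|) => // n /= xn.
      rewrite /un; congr _%:E; apply/min_idPl.
      rewrite (le_trans (ler_norm _))// (le_trans (ltW (archi_boundP (normr_ge0 _))))//.
      by rewrite ler_nat.
    apply: cvg_monotone_convergence => //.
    - by move=> n; apply/measurable_EFinP; exact: mun.
    - move=> x xab m n mn; rewrite /= lee_fin le_min !ge_min lexx/= ler_nat.
      by rewrite mn orbT.
  rewrite -(cvg_lim _ cvgun)//; apply: lime_le; first by apply/cvg_ex; eexists; exact: cvgun.
  by near=> n.
(* As [un n <= u], one has [(E^2)' <= G - u <= h] with [h] integrable. Hence [E^2] minus the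
   primitive of [h] is nonincreasing, and [E a = 0] gives [0 <= E b ^ 2 <= int h]. *)
pose h x := G x - un n x.
pose g := h \_ `]a, b[.
have ih : mu.-integrable `]a, b[ (EFin \o h).
  rewrite (_ : _ \o _ = ((EFin \o G) \- (EFin \o un n))%E)//.
  exact: integrableB.
have ig : mu.-integrable setT (EFin \o g).
  by move/integrable_mkcond : ih; rewrite restrict_EFin; apply.
suff : 0 <= primitiveNy g b - primitiveNy g a.
  rewrite primitiveNyB//.
  rewrite -Rintegral_itv_bndo_bndc; last exact: integrableS ig.
  have -> : \int[mu]_(x in `]a, b[) g x = \int[mu]_(x in `]a, b[) h x.
    by apply: eq_Rintegral => x xab; rewrite /g patchE xab.
  rewrite RintegralB// subr_ge0 -lee_fin /Rintegral !fineK//.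
  - by apply: integrable_fin_num => //; exact: iG.
  - by apply: integrable_fin_num => //; exact: (iun n).
have : E b ^+ 2 - primitiveNy g b <= E a ^+ 2 - primitiveNy g a.
  apply: (@abs_continuous_nonincreasing a b (fun x => E x ^+ 2 - primitiveNy g x)) => //.
    apply: abs_continuousB; first exact: abs_continuous_sqr.
    exact: abs_continuous_primitiveNy.
  have lg : locally_integrable setT g by apply: open_integrable_locally => //; exact: openT.
  have igy y : mu.-integrable `]-oo, y] (EFin \o g) by exact: integrableS ig.
  have FTC := FTC1Ny igy lg.
  move: HE FTC; apply: filterS2; first exact: (ae_filter_ringOfSetsType mu).
  move=> x Ex [Ix1 Ix2] axb.
  have [dE HE] := Ex axb.
  have iE : is_derive x (1 : R) E (derive1 E x) by rewrite derive1E; exact: derivableP.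
  have iI : is_derive x (1 : R) (primitiveNy g) (g x).
    by rewrite -Ix2 derive1E; exact: derivableP.
  have iall : is_derive x (1 : R) (fun x => E x ^+ 2 - primitiveNy g x)
      (2 * E x * derive1 E x - g x).
    have iEI := is_deriveB (is_deriveX 2 iE) iI.
    apply: (is_derive_eq iEI).
    by rewrite /GRing.scale/=; ring.
  split; first exact: ex_derive.
  rewrite derive1E derive_val /g patchE mem_set ?/h/=; last by rewrite in_itv.
  rewrite opprB; have : un n x <= u x by rewrite ge_min lexx.
  by move: HE; rewrite -/(u x); lra.
by rewrite Ea expr0n/= sub0r; have := sqr_ge0 (E b); lra.
Unshelve. all: by end_near. Qed.

End AbsContinuous.
(** * Lebesgue measure of space, disintegrated along parallel lines *)

Section Volume.
Context {R : realType}.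

(* Mathcomp-analysis attaches the sigma-finite structure of a product measure to
   products of subprobabilities only, hence the following instances. *)
Lemma product_measure1_sigma_finite d1 d2 (T1 : measurableType d1)
    (T2 : measurableType d2) (m1 : {sigma_finite_measure set T1 -> \bar R})
    (m2 : {sigma_finite_measure set T2 -> \bar R}) :
  sigma_finite setT (m1 \x m2)%E.
Proof.
have /sigma_finiteP[F [TF ndF Foo]] := sigma_finiteT m1.
have /sigma_finiteP[G [TG ndG Goo]] := sigma_finiteT m2.
exists (fun n => F n `*` G n).
  rewrite -setXTT TF TG predeqE => -[x y]; split.
    move=> [/= [n _ Fnx] [k _ Gky]]; exists (maxn n k) => //; split.
    - by move: x Fnx; exact/subsetPset/ndF/leq_maxl.
    - by move: y Gky; exact/subsetPset/ndG/leq_maxr.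
  by move=> [n _ []/= ? ?]; split; exists n.
move=> k; have [? ?] := Foo k; have [? ?] := Goo k.
split; first exact: measurableX.
by rewrite product_measure1E// lte_mul_pinfty// ge0_fin_numE.
Qed.

Notation RT := (measurableTypeR R).
Notation R3 := (RT * RT * RT)%type.
Notation mu := (@lebesgue_measure R).

Definition area : set (RT * RT)%type -> \bar R := (mu \x mu)%E.

HB.instance Definition _ := Measure.copy area (mu \x mu)%E.
HB.instance Definition _ := @Measure_isSigmaFinite.Build _ (RT * RT)%type R area
  (product_measure1_sigma_finite mu mu).

Definition volume : set R3 -> \bar R := (area \x mu)%E.

HB.instance Definition _ := Measure.copy volume (area \x mu)%E.
HB.instance Definition _ := @Measure_isSigmaFinite.Build _ R3 R volume
  (product_measure1_sigma_finite area mu).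

Lemma leb3E : @leb3 R = volume. Proof. by []. Qed.

(** The image of the measure under the translation gives half-open intervals their length, which
    characterises Lebesgue measure. *)
Lemma lebesgue_measure_translation (c : R) (f : RT -> \bar R) :
  measurable_fun setT f -> (forall x, 0 <= f x)%E ->
  (\int[mu]_x f ((x : R) + c)%R = \int[mu]_x f x)%E.
Proof.
move=> mf f0.
pose phi (x : RT) : RT := (x : R) + c.
have mphi : measurable_fun [set: RT] phi by exact: measurable_funD.
transitivity (\int[pushforward mu phi]_x f x)%E.
  by rewrite (@ge0_integral_pushforward _ _ _ _ _ phi mphi)//= preimage_setT.
apply: eq_measure_integral => A mA _; apply/esym/lebesgue_measure_unique => // X.
move=> [[a b] _ <-] /=; rewrite /pushforward.
have -> : phi @^-1` [set` `]a, b]] = [set` `](a - c), (b - c)]].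
  by apply/seteqP; split => x /=; rewrite !in_itv/= ltrBlDr lerBrDr.
rewrite !lebesgue_measure_itv/= !lte_fin ltrD2r; case: ifP => // _.
by rewrite -!EFinD; congr _%:E; ring.
Qed.

(** Phrased with integrals of nonnegative functions rather than measures of sets, so that it passes
    to products by Tonelli's theorem. *)
Definition integral_preserving d (T : measurableType d)
    (m : set T -> \bar R) (phi : T -> T) : Prop :=
  measurable_fun setT phi /\
  forall f : T -> \bar R, measurable_fun setT f -> (forall x, 0 <= f x)%E ->
    (\int[m]_x f (phi x) = \int[m]_x f x)%E.

(** Tonelli's theorem in both orders: the second coordinate is transformed with the first one fixed,
    then conversely. *)
Lemma integral_preserving_prod d1 d2 (T1 : measurableType d1)
    (T2 : measurableType d2) (m1 : {sigma_finite_measure set T1 -> \bar R})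
    (m2 : {sigma_finite_measure set T2 -> \bar R}) (phi1 : T1 -> T1)
    (phi2 : T2 -> T2) :
  integral_preserving m1 phi1 -> integral_preserving m2 phi2 ->
  integral_preserving (m1 \x m2)%E (fun x => (phi1 x.1, phi2 x.2)).
Proof.
move=> [mphi1 phi1P] [mphi2 phi2P].
have mphi : measurable_fun setT (fun x : T1 * T2 => (phi1 x.1, phi2 x.2)).
  by apply: measurable_fun_pair; apply: measurableT_comp.
split => // f mf f0.
pose f2 x := f (phi1 x.1, x.2).
have mf2 : measurable_fun setT f2.
  apply: measurableT_comp => //; apply: measurable_fun_pair => //.
  exact: measurableT_comp.
have f20 z : (0 <= f2 z)%E by exact: f0.
rewrite (@fubini_tonelli1 _ _ _ _ _ m1 m2 (fun x => f (phi1 x.1, phi2 x.2)))//;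
  last exact: (measurableT_comp mf mphi).
transitivity (\int[m1]_x \int[m2]_y f2 (x, y))%E.
  apply: eq_integral => x _.
  apply: (phi2P (fun y => f2 (x, y))); last by move=> y; exact: f0.
  exact: (measurableT_comp mf2 (pair1_measurable x)).
transitivity (\int[m1 \x m2]_z f2 z)%E.
  by rewrite (@fubini_tonelli1 _ _ _ _ _ m1 m2 f2).
rewrite (@fubini_tonelli2 _ _ _ _ _ m1 m2 f2)// (@fubini_tonelli2 _ _ _ _ _ m1 m2 f)//.
apply: eq_integral => y _; apply: (phi1P (fun x => f (x, y))); last by move=> x; exact: f0.
exact: (measurableT_comp mf (pair2_measurable y)).
Qed.

Lemma volume_translation (v : point3 R) :
  integral_preserving volume (fun x : R3 => ((x : point3 R) + v)%R : R3).
Proof.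
have P1 c : integral_preserving mu (fun x : RT => ((x : R) + c)%R : RT).
  by split; [exact: measurable_funD | exact: lebesgue_measure_translation].
have P2 := integral_preserving_prod (P1 v.1.1) (P1 v.1.2).
exact: (@integral_preserving_prod _ _ _ _ area mu _ _ P2 (P1 v.2)).
Qed.

Definition line_pt (Om : point3 R) (z : R3 * RT) : R3 :=
  ((z.1 : point3 R) + (z.2 : R) *: Om)%R.

Lemma measurable_line_pt Om : measurable_fun setT (line_pt Om).
Proof.
have m1 (p : R3 -> RT) (c : R) : measurable_fun setT p ->
    measurable_fun setT (fun z : R3 * RT => (p z.1 : R) + (z.2 : R) * c : RT).
  move=> mp; apply: measurable_funD; first exact: measurableT_comp.
  exact: measurable_funM.
apply: measurable_fun_pair; last exact: m1.
apply: measurable_fun_pair.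
  by apply: (m1 (fun x => x.1.1)); apply: measurableT_comp.
by apply: (m1 (fun x => x.1.2)); apply: measurableT_comp.
Qed.

(** For each [s] the translate of [N] by [s *: Om] is null, so the double integral of the indicator
    over [r] and [s] vanishes; Tonelli's theorem then gives almost every [r]. *)
Lemma line_negligible Om (N : set R3) : measurable N -> volume N = 0%E ->
  {ae volume, forall r, {ae mu, forall s, ~ N (line_pt Om (r, s))}}.
Proof.
move=> mN N0.
pose f (z : R3 * RT) : \bar R := (\1_N (line_pt Om z))%:E.
have mf : measurable_fun setT f.
  apply/measurable_EFinP; apply: measurableT_comp => //.
  exact: measurable_line_pt.
have f0 z : (0 <= f z)%E by rewrite lee_fin.
have : (\int[volume]_r `|\int[mu]_s f (r, s)| = 0)%E.
  under eq_integral do rewrite gee0_abs ?integral_ge0//.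
  rewrite -[LHS](@fubini_tonelli1 _ _ _ _ _ volume mu f)//.
  rewrite (@fubini_tonelli2 _ _ _ _ _ volume mu f)//.
  rewrite integral0_eq// => s _; rewrite /fubini_G /f.
  have [_ tr] := volume_translation ((s : R) *: Om).
  rewrite (tr (fun x => (\1_N x)%:E))//; last first.
    by apply/measurable_EFinP.
  by rewrite integral_indic// setIT.
move/(ae_eq_integral_abs _ measurableT).
have mF := @measurable_fun_fubini_tonelli_F _ _ _ _ _ mu f mf f0.
move/(_ mF); apply: filterS => r /(_ I) /= fr.
have : (\int[mu]_s `|f (r, s)| = 0)%E.
  by under eq_integral do rewrite gee0_abs//.
move/(ae_eq_integral_abs _ measurableT).
have mfr : measurable_fun setT (fun s => f (r, s)).
  exact: (measurableT_comp mf (pair1_measurable r)).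
move=> /(_ mfr); apply: filterS => s /(_ I) /= /eqP.
by rewrite /f eqe indicE pnatr_eq0 eqb0 => /negP + Ns; apply; rewrite inE.
Qed.

Lemma measurable_slab (Om : point3 R) :
  measurable [set x : R3 | 0 <= dot x Om <= 1].
Proof.
have mdot : measurable_fun setT (fun x : R3 => dot x Om : RT).
  by apply: measurable_funD; [apply: measurable_funD|];
    apply: measurable_funM => //; do ?apply: measurableT_comp.
set S := [set x : R3 | _].
rewrite (_ : S = (fun x : R3 => dot x Om : RT) @^-1` `[0, 1]).
  rewrite -[X in measurable X]setTI; apply: mdot => //.
by apply/seteqP; split => x; rewrite /S /= in_itv.
Qed.

(* The slab [0 <= r . Om <= 1] cuts a segment of length 1 on each line of
   direction [Om]; this avoids rotating coordinates. *)
Lemma volume_line_integral (Om : point3 R) (f : R3 -> \bar R) : dot Om Om = 1 ->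
  measurable_fun setT f -> (forall x, 0 <= f x)%E ->
  (\int[volume]_r f r = \int[volume]_r
     ((\1_[set x : R3 | 0 <= dot x Om <= 1] r)%:E * \int[mu]_s f (line_pt Om (r, s))))%E.
Proof.
move=> Om1 mf f0; set S := [set x : R3 | _].
have mS : measurable S by exact: measurable_slab.
pose g (z : R3 * RT) : \bar R := ((\1_S z.1)%:E * f (line_pt Om z))%E.
have mg : measurable_fun setT g.
  apply: emeasurable_funM.
    by apply/measurable_EFinP; apply: measurableT_comp => //.
  by apply: measurableT_comp => //; exact: measurable_line_pt.
have g0 z : (0 <= g z)%E by rewrite mule_ge0// lee_fin.
transitivity (\int[volume]_r \int[mu]_s g (r, s))%E; last first.
  apply: eq_integral => r _; rewrite /g /= ge0_integralZl//.
  apply: (measurableT_comp mf).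
  exact: (measurableT_comp (measurable_line_pt Om) (pair1_measurable r)).
rewrite -[RHS](@fubini_tonelli1 _ _ _ _ _ volume mu g)//.
rewrite (@fubini_tonelli2 _ _ _ _ _ volume mu g)//.
(* For fixed [s], translating [r] by [s *: Om] moves the parameter from [f] to the slab indicator.
   What remains is the length of the set of [s] with [r - s *: Om] in the slab, which is 1. *)
pose k (z : R3 * RT) : \bar R := ((\1_S (line_pt (- Om)%R z))%:E * f z.1)%E.
have mk : measurable_fun setT k.
  apply: emeasurable_funM.
    apply/measurable_EFinP; apply: measurableT_comp => //.
    exact: measurable_line_pt.
  exact: measurableT_comp.
have k0 z : (0 <= k z)%E by rewrite mule_ge0// lee_fin.
transitivity (\int[mu]_s \int[volume]_r k (r, s))%E; last first.
  apply: eq_integral => s _; rewrite /fubini_G.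
  have [_ tr] := volume_translation ((s : R) *: Om).
  rewrite -(tr (fun r => k (r, s)))//; last first.
    exact: (measurableT_comp mk (pair2_measurable s)).
  apply: eq_integral => r _; rewrite /k /g /=; congr ((\1_S _)%:E * _)%E.
  by rewrite /line_pt/= scalerN addrK.
rewrite -[RHS](@fubini_tonelli2 _ _ _ _ _ volume mu k)//.
rewrite (@fubini_tonelli1 _ _ _ _ _ volume mu k)//.
apply: eq_integral => r _; rewrite /fubini_F /k /=.
under eq_integral do rewrite muleC.
rewrite ge0_integralZl//; last first.
  apply/measurable_EFinP; apply: measurableT_comp => //.
  exact: (measurableT_comp (measurable_line_pt (- Om)) (pair1_measurable r)).
have dot_line s : dot (line_pt (- Om) (r, s)) Om = dot r Om - s.
  rewrite -[s in RHS]mulr1 -Om1 /line_pt /dot/=.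
  rewrite /GRing.scale/=; ring.
have -> : (fun s : RT => (\1_S (line_pt (- Om) (r, s)))%:E) =
    (fun s => (\1_(`[(dot r Om - 1)%R, dot r Om]%classic : set RT) s)%:E : \bar R).
  apply/funext => s; congr (_%:E); rewrite !indicE; congr (_%:R); congr nat_of_bool.
  apply/idP/idP; rewrite !inE /S/= in_itv/=.
    rewrite dot_line => /andP[d0 d1]; lra.
  rewrite dot_line => /andP[d0 d1]; lra.
have unit_mass : mu `[dot r Om - 1, dot r Om] = 1%E.
  rewrite lebesgue_measure_itv/= lte_fin ltrBlDr ltrDl ltr01 -EFinB opprB.
  by rewrite addrCA subrr addr0.
by rewrite integral_indic// setIT [X in (_ * X)%E]unit_mass mule1.
Qed.

Lemma le_volume_line_integral (Om : point3 R) (f g : R3 -> \bar R) : dot Om Om = 1 ->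
  measurable_fun setT f -> (forall x, 0 <= f x)%E ->
  measurable_fun setT g -> (forall x, 0 <= g x)%E ->
  {ae volume, forall r,
    (\int[mu]_s f (line_pt Om (r, s)) <= \int[mu]_s g (line_pt Om (r, s)))%E} ->
  (\int[volume]_r f r <= \int[volume]_r g r)%E.
Proof.
move=> Om1 mf f0 mg g0 fg.
rewrite (volume_line_integral Om1 mf f0) (volume_line_integral Om1 mg g0).
have mline h : measurable_fun setT h -> (forall x, 0 <= h x)%E ->
    measurable_fun setT (fun r : R3 =>
      (\1_[set x : R3 | 0 <= dot x Om <= 1] r)%:E * \int[mu]_s h (line_pt Om (r, s)))%E.
  move=> mh h0; apply: emeasurable_funM.
    apply/measurable_EFinP; apply: measurable_indic; exact: measurable_slab.
  apply: (@measurable_fun_fubini_tonelli_F _ _ _ _ _ mu (h \o line_pt Om)).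
    apply: measurableT_comp => //; exact: measurable_line_pt.
  by move=> z; exact: h0.
have pos h r : (forall x, 0 <= h x)%E -> (0 <= \int[mu]_s h (line_pt Om (r, s)))%E.
  by move=> h0; apply: integral_ge0 => s _; exact: h0.
apply: ae_ge0_le_integral => //.
- by move=> r _; rewrite mule_ge0 ?pos// lee_fin.
- exact: mline.
- by move=> r _; rewrite mule_ge0 ?pos// lee_fin.
- exact: mline.
- by apply: filterS fg => r fgr _; rewrite lee_wpmul2l// lee_fin.
Qed.

(** An open set is the union of the countably many cubes with rational centre and radius
    [1 / (n + 1)] that it contains; this links the topology with the product sigma-algebra. *)
Lemma open_measurable3 (A : set (point3 R)) : open A -> measurable (A : set R3).
Proof.
move=> oA.
pose bx (q : rat * rat * rat * nat) : set R3 :=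
  (ball (ratr q.1.1.1 : R) (q.2.+1%:R^-1) `*` ball (ratr q.1.1.2 : R) (q.2.+1%:R^-1))
  `*` ball (ratr q.1.2 : R) (q.2.+1%:R^-1).
have mbx q : measurable (bx q).
  apply: measurableX; last exact: measurable_ball.
  by apply: measurableX; exact: measurable_ball.
rewrite (_ : A = \bigcup_q (if `[< bx q `<=` A >] then bx q else set0)).
  apply: countable_bigcupT_measurable => // q.
  by case: ifP.
apply/seteqP; split => [x Ax|x [q _]]; last by case: asboolP => // qA /qA.
have [e /= e0 eA] : exists2 e : R, 0 < e & ball x e `<=` A.
  by have /nbhs_ballP[e e0 eA] := oA x Ax; exists e.
(* The cube is centred near [x], not at [x], so twice its radius has to fit into [e]. *)
have [n ne] : exists n : nat, n.+1%:R^-1 + n.+1%:R^-1 <= e :> R.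
  exists (Num.Def.archi_bound (2 / e)).
  set k := Num.Def.archi_bound _.
  have : 2 / e < k%:R by apply: archi_boundP; rewrite divr_ge0// ltW.
  rewrite ltr_pdivrMr// => ke.
  have k1 : 0 < k.+1%:R :> R by [].
  have -> : k.+1%:R^-1 + k.+1%:R^-1 = 2 / k.+1%:R :> R by field; rewrite nat1r gt_eqF.
  rewrite ler_pdivrMr// (le_trans (ltW ke))// mulrC.
  by rewrite ler_wpM2l ?(ltW e0)// ler_nat.
have rat_near (y : R) : exists q : rat, ball (ratr q : R) (n.+1%:R^-1) y.
  have [|q] := @rat_in_itvoo R (y - n.+1%:R^-1) (y + n.+1%:R^-1).
    by rewrite ltrBlDr -addrA ltrDl addr_gt0.
  rewrite in_itv/= => /andP[q1 q2]; exists q.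
  by rewrite /ball/= distrC ltr_distlC q1.
have [q1 h1] := rat_near x.1.1; have [q2 h2] := rat_near x.1.2.
have [q3 h3] := rat_near x.2.
exists (q1, q2, q3, n) => //; rewrite asboolT//.
move=> y [[/= y1 y2] y3]; apply: eA.
have near_ (q : rat) (a b : R) : ball (ratr q : R) n.+1%:R^-1 a ->
    ball (ratr q : R) n.+1%:R^-1 b -> ball a e b.
  by move=> qa qb; apply: le_ball ne _ _; apply: ball_triangle qb; exact: ball_sym.
split; last exact: near_ h3 y3.
by split; [exact: near_ h1 y1|exact: near_ h2 y2].
Qed.

Lemma line_continuous (r v : point3 R) : continuous (fun s : R => r + s *: v).
Proof.
move=> s; apply: cvgD; first exact: cvg_cst.
by apply: cvgZr_tmp => //; exact: cvg_id.
Qed.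

Lemma dot_unit_neq0 (v : point3 R) : dot v v = 1 -> v != 0.
Proof.
move=> v1; apply/eqP => v0; move: v1; rewrite v0 /dot/= !mulr0 !addr0.
by move=> /eqP; rewrite eq_sym oner_eq0.
Qed.

(** The section is an interval by convexity, has finite ends by boundedness and excludes them by
    openness. The end [a] is singled out because it will carry the inflow condition. *)
Lemma line_section (D : set (point3 R)) (r Om : point3 R) :
  bounded_convex_domain D -> Om != 0 ->
  [set s : R | D (r + s *: Om)] = set0 \/
  exists a b, [/\ a < b, [set s : R | D (r + s *: Om)] = `]a, b[%classic &
    boundary D (r + a *: Om)].
Proof.
move=> [_ oD bD cD] Om0; set S := [set s | _].
have [->|/set0P S0] := eqVneq S set0; [by left|right].
have oS : open S by apply: open_comp oD => s _; exact: line_continuous.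
have cS : is_interval S.
  move=> x y Sx Sy z /andP[xz zy].
  have [xy|xy] := eqVneq x y.
    by have -> : z = x by apply/eqP; rewrite eq_le {1}xy zy.
  have yx0 : 0 < y - x by rewrite subr_gt0 lt_neqAle xy (le_trans xz).
  have l0 : 0 <= (y - z) / (y - x) by rewrite divr_ge0 ?(ltW yx0)// subr_ge0.
  have l1 : (y - z) / (y - x) <= 1 by rewrite ler_pdivrMr// mul1r lerB.
  have := @cD (r + x *: Om) (r + y *: Om) (Itv01 l0 l1).
  rewrite !inE => /(_ Sx Sy); rewrite /S /=.
  suff -> : conv (Itv01 l0 l1) (r + x *: Om : convex_lmodType _) (r + y *: Om) = r + z *: Om by [].
  pose l := (y - z) / (y - x).
  transitivity (l *: (r + x *: Om) + (1 - l) *: (r + y *: Om)); first by [].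
  rewrite !scalerDr !scalerA addrACA -!scalerDl subrKC scale1r.
  by congr (_ + _ *: _); rewrite /l; field; rewrite gt_eqF.
have [M [M0 SM]] : exists M : R, 0 < M /\ forall s, S s -> `|s| <= M.
  have [M [_ HM]] := bD.
  have N0 : 0 < `|Om| by rewrite normr_gt0.
  have M1 : 0 < `|M| + 1 by rewrite ltr_wpDl.
  exists ((`|M| + 1 + `|r|) / `|Om|); split.
    by rewrite divr_gt0// ltr_pwDl.
  move=> s Ss; rewrite ler_pdivlMr// -normrZ.
  have -> : s *: Om = (r + s *: Om) - r by rewrite addrAC subrr add0r.
  rewrite (le_trans (ler_normB _ _))// lerD2r.
  apply: HM Ss; rewrite (le_lt_trans (ler_norm _))// ltrDl//.
have hS : has_inf S /\ has_sup S.
  split; split => //; [exists (- M)|exists M] => s /SM.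
    by rewrite ler_norml => /andP[].
  by rewrite ler_norml => /andP[].
case: hS => hi hs.
pose a := inf S; pose b := sup S.
have Sopen s : S s -> exists2 e : R, 0 < e & forall t, `|s - t| < e -> S t.
  by move=> Ss; have /nbhs_ballP[e /= e0 eS] := oS s Ss; exists e.
have Sab s : S s -> a < s < b.
  move=> Ss; have [e e0 eS] := Sopen s Ss.
  apply/andP; split.
    apply: (@le_lt_trans _ _ (s - e / 2)).
      apply: ge_inf; first by case: hi.
      by apply: eS; rewrite opprB addrC subrK gtr0_norm; lra.
    by rewrite ltrBlDr ltrDl divr_gt0.
  apply: (@lt_le_trans _ _ (s + e / 2)).
    by rewrite ltrDl divr_gt0.
  apply: ub_le_sup; first by case: hs.
  by apply: eS; rewrite opprD addrA subrr add0r normrN gtr0_norm; lra.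
have abS s : a < s < b -> S s.
  move=> /andP[sa sb].
  have [x Sx xs] : exists2 x, S x & x < s.
    have [|x Sx] := @inf_adherent _ S (s - a) _ hi; first by rewrite subr_gt0.
    by rewrite addrC subrK => ?; exists x.
  have [y Sy sy] : exists2 y, S y & s < y.
    have [|y Sy] := @sup_adherent _ S (b - s) _ hs; first by rewrite subr_gt0.
    by rewrite opprB addrC subrK => ?; exists y.
  by apply: (cS x y) => //; rewrite (ltW xs) (ltW sy).
have ab : a < b by case: S0 => s /Sab /andP[]; exact: lt_trans.
exists a, b; split => //.
  by apply/seteqP; split => s /=; rewrite in_itv/=; [exact: Sab|exact: abS].
split.
  move=> B raB; have /nbhs_ballP[e /= e0 eB] :=
    @line_continuous r Om a _ raB.
  pose s := Num.min (a + e / 2) ((a + b) / 2).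
  have as_ : a < s by rewrite lt_min; lra.
  exists (r + s *: Om); split.
    by apply: abS; rewrite as_/= gt_min; apply/orP; right; lra.
  apply: eB; rewrite /ball/= distrC gtr0_norm ?subr_gt0//.
  have : s <= a + e / 2 by rewrite ge_min lexx.
  lra.
by move=> /interior_subset/Sab; rewrite ltxx.
Qed.

End Volume.
(** * The transport equation *)

Section TransportEnergy.
Context {R : realType}.
Notation RT := (measurableTypeR R).
Notation R3 := (RT * RT * RT)%type.
Notation mu := (@lebesgue_measure R).

(** Regularity is known with the parameter starting at a good point of a line; this moves the origin
    back to the common base point. *)
Lemma abs_continuous_shift a b c (f : R -> R) :
  abs_continuous (a - c) (b - c) (fun t => f (c + t)) -> abs_continuous a b f.
Proof.
move=> fac e e0; have [d d0 fd] := fac e e0.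
exists d => // s s1 s2 s3.
have := fd [seq (p.1 - c, p.2 - c) | p <- s]; rewrite !big_map/=.
have -> : \sum_(p <- s) (p.2 - c - (p.1 - c)) = \sum_(p <- s) (p.2 - p.1).
  by apply: eq_bigr => p _; ring.
have -> : \sum_(p <- s) `|f (c + (p.2 - c)) - f (c + (p.1 - c))| =
    \sum_(p <- s) `|f p.2 - f p.1|.
  by apply: eq_bigr => p _; rewrite !subrKC.
apply => //.
  rewrite all_map; apply: sub_all s1 => p /= /and3P[? ? ?].
  by rewrite !lerD2r; apply/and3P.
rewrite pairwise_map; apply: sub_pairwise s2 => p q /=.
by rewrite lerD2r.
Qed.

Lemma derive_line (u : point3 R -> R) (r Om : point3 R) (s : R) :
  derivable u (r + s *: Om) Om ->
  derivable (fun t : R => u (r + t *: Om)) s 1 /\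
  derive1 (fun t : R => u (r + t *: Om)) s = 'D_Om u (r + s *: Om).
Proof.
rewrite derive1E /derivable /derive.
rewrite (_ : (fun h : R => h^-1 *: (u (r + (h *: 1 + s) *: Om) - u (r + s *: Om)))
  = (fun h : R => h^-1 *: (u (h *: Om + (r + s *: Om)) - u (r + s *: Om)))) //.
apply/funext => h; congr (_ *: (u _ - _)).
by rewrite [h *: 1]mulr1 scalerDl addrCA.
Qed.

(** The normal cone inequality is not strict by itself. Applied to a point of the chord pushed
    slightly along the normal, still in the open set [D], it gains the positive term [e / 2]; this
    covers edges and corners as well. *)
Lemma outward_normal_inflow (D : set (point3 R)) nv (r Om : point3 R) (a b : R) :
  open D -> outward_normal D nv -> a < b ->
  boundary D (r + a *: Om) -> (forall s, a < s < b -> D (r + s *: Om)) ->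
  dot Om (nv (r + a *: Om)) < 0.
Proof.
move=> oD nvP ab bra Dr; have [n1 nle] := nvP _ bra; set n := nv _ in n1 nle *.
pose s := (a + b) / 2.
have Ds : D (r + s *: Om) by apply: Dr; rewrite /s; lra.
have : nbhs (0 : R) [set e : R | D (r + s *: Om + e *: n)].
  apply: (@line_continuous _ (r + s *: Om) n 0).
  by rewrite scale0r addr0; apply: open_nbhs_nbhs.
move=> /nbhs_ballP[e /= e0 eD].
have /eD/nle : ball (0 : R) e (e / 2).
  by rewrite /ball/= sub0r normrN gtr0_norm; lra.
have -> : r + s *: Om + (e / 2) *: n - (r + a *: Om) = (s - a) *: Om + (e / 2) *: n.
  by rewrite scalerBl opprD addrAC addrACA subrr add0r.
have -> : dot n ((s - a) *: Om + (e / 2) *: n) = (s - a) * dot Om n + (e / 2) * dot n n.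
  by rewrite /dot/= /GRing.scale/=; ring.
rewrite n1 => nneg; have : (s - a) * dot Om n < 0 by lra.
by rewrite pmulr_rlt0// subr_gt0 /s; lra.
Qed.

Lemma measurable_line (D : set (point3 R)) (Om r : point3 R) (S : set R)
    (f : point3 R -> R) : measurable (D : set R3) ->
  (forall s, S s -> D (r + s *: Om)) -> measurable_fun (D : set R3) (f : R3 -> RT) ->
  measurable S ->
  measurable_fun (S : set RT) (fun s : RT => f (r + (s : R) *: Om)).
Proof.
move=> mD SD mf mS.
apply: (@measurable_comp _ _ _ RT R3 RT (D : set R3) f S (fun s : RT => line_pt Om (r, s))) => //.
  by move=> _ [s Ss <-]; exact: SD.
apply: measurable_funTS.
exact: (measurableT_comp (measurable_line_pt Om) (pair1_measurable r)).
Qed.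

Lemma measurable_fun_inv_pos (D : set (point3 R)) (f : point3 R -> R) :
  measurable_fun D f -> (forall r, D r -> 0 < f r) ->
  measurable_fun D (fun r => (f r)^-1).
Proof.
move=> mf f0; apply: (@measurable_comp _ _ _ R3 RT RT (`]0, +oo[%classic : set R)
  (fun x : R => x^-1) (D : set R3) f) => //.
  by move=> _ [r /f0 ? <-] /=; rewrite in_itv/= andbT.
apply: open_continuous_measurable_fun; first exact: interval_open.
move=> x; rewrite inE/= in_itv/= andbT => x0.
by apply: inv_continuous; rewrite gt_eqF.
Qed.

(* Along almost every line of direction [Om] the difference [E = u - v] is
   absolutely continuous on the chord of [D], vanishes at its inflow end, and
   satisfies [2 E E' + sig E^2 <= (q1 - q2)^2 / sig] since [E' = q1 - q2 - sig E]. *)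
Lemma transport_energy (D : set (point3 R)) nv (Om : point3 R)
    (sig q1 q2 g u v : point3 R -> R) :
  bounded_convex_domain D -> outward_normal D nv -> dot Om Om = 1 ->
  measurable_fun D sig -> (forall r, D r -> 0 < sig r) ->
  measurable_fun D (fun r => q1 r - q2 r) ->
  transport_solution D nv Om sig q1 g u ->
  transport_solution D nv Om sig q2 g v ->
  (\int[leb3]_(r in D) (sig r * (u r - v r) ^+ 2)%:E <=
   \int[leb3]_(r in D) ((q1 r - q2 r) ^+ 2 / sig r)%:E)%E.
Proof.
move=> bcD nvP Om1 msig sig0 mq [mu_ uac ueq ubd] [mv vac veq vbd].
have oD : open D by case: bcD.
have mD : measurable (D : set R3) by exact: open_measurable3.
have mE : measurable_fun D (fun r => sig r * (u r - v r) ^+ 2).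
  by apply: measurable_funM => //; apply: measurable_funX; exact: measurable_funB.
have mG : measurable_fun D (fun r => (q1 r - q2 r) ^+ 2 / sig r).
  apply: measurable_funM; first exact: measurable_funX.
  exact: measurable_fun_inv_pos.
have E0 r : D r -> 0 <= sig r * (u r - v r) ^+ 2.
  by move=> /sig0 s0; rewrite mulr_ge0 ?sqr_ge0// ltW.
have G0 r : D r -> 0 <= (q1 r - q2 r) ^+ 2 / sig r.
  by move=> /sig0 s0; rewrite mulr_ge0 ?sqr_ge0// invr_ge0 ltW.
have patch0 h : (forall r, D r -> 0 <= h r) -> forall r : R3, (0 <= ((EFin \o h) \_ D) r)%E.
  by move=> h0 r; rewrite patchE; case: ifPn => // /set_mem Dr; rewrite lee_fin h0.
have mpatch (h : point3 R -> R) : measurable_fun D h ->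
    measurable_fun [set: R3] ((EFin \o h) \_ D).
  move=> mh; apply/(measurable_restrictT _ _).1 => //.
  by apply/measurable_EFinP; exact: mh.
rewrite !leb3E integral_mkcond [leRHS]integral_mkcond.
apply: (le_volume_line_integral Om1).
- exact: mpatch.
- exact: patch0.
- exact: mpatch.
- exact: patch0.
have aeF := ae_filter_ringOfSetsType (@volume R).
(* One null set outside which both solutions satisfy their equations and are absolutely continuous
   along the line. *)
have [N [mN N0 badN]] := @filterI _ _ aeF _ _ (@filterI _ _ aeF _ _ uac vac)
  (@filterI _ _ aeF _ _ ueq veq).
have : {ae volume, forall r, {ae mu, forall s, ~ N (line_pt Om (r, s))}}.
  exact: line_negligible.
apply: filterS => r aer.
have line_int (h : point3 R -> R) (S : set R) : [set s : R | D (r + s *: Om)] = S ->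
    (\int[mu]_s ((EFin \o h) \_ D) (line_pt Om (r, s)) =
     \int[mu]_(s in S) (h (r + (s : R) *: Om))%:E)%E.
  move=> <-; rewrite [RHS]integral_mkcond; apply: eq_integral => s _.
  by rewrite !patchE /=; congr (if _ then _ else _); apply/idP/idP; rewrite !inE.
have [Dr0|[a [b [ab Drab bra]]]] := line_section r bcD (dot_unit_neq0 Om1).
  by rewrite !(line_int _ _ Dr0) !integral_set0.
rewrite !(line_int _ _ Drab).
have Dab s : a < s < b -> D (r + s *: Om).
  move=> sab; have : `]a, b[%classic s by rewrite /= in_itv.
  by rewrite -Drab.
have Dab' s : `]a, b[%classic s -> D (r + s *: Om) by rewrite -Drab.
(* The base point [r] may itself be bad or lie outside [D], whereas a chord of positive length
   contains a good point. *)
have [s0 s0ab s0N] : exists2 s0, a < s0 < b & ~ N (r + s0 *: Om).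
  have [A [mA A0 NA]] := aer.
  apply: contrapT => H.
  have abA : `]a, b[ `<=` A.
    move=> s /=; rewrite in_itv/= => sab; apply: NA => /= Ns.
    by apply: H; exists s.
  have mab : mu `]a, b[ = (b - a)%:E by rewrite lebesgue_measure_itv/= lte_fin ab.
  have := le_measure mu (mem_set (measurable_itv `]a, b[)) (mem_set mA) abA.
  rewrite [X in (_ <= X)%E]A0 [X in (X <= _)%E]mab lee_fin.
  by rewrite leNgt subr_gt0 ab.
have good x : ~ N x -> D x ->
   ((forall c d : R, c < d -> (forall t, c < t < d -> D (x + t *: Om)) ->
      abs_continuous c d (fun t => u (x + t *: Om))) /\
    (forall c d : R, c < d -> (forall t, c < t < d -> D (x + t *: Om)) ->
      abs_continuous c d (fun t => v (x + t *: Om)))) /\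
   ((derivable u x Om /\ 'D_Om u x + sig x * u x = q1 x) /\
    (derivable v x Om /\ 'D_Om v x + sig x * v x = q2 x)).
  move=> xN Dx; have [[Hu Hv] [Hu' Hv']] := contrapT (fun H => xN (badN x H)).
  split; first by split; [exact: Hu|exact: Hv].
  by split; [exact: Hu'|exact: Hv'].
pose E s := u (r + s *: Om) - v (r + s *: Om).
have ac_ab (h : point3 R -> R) :
   (forall c d : R, c < d -> (forall t, c < t < d -> D (r + s0 *: Om + t *: Om)) ->
      abs_continuous c d (fun t => h (r + s0 *: Om + t *: Om))) ->
   abs_continuous a b (fun s => h (r + s *: Om)).
  move=> hac; apply: (@abs_continuous_shift _ _ s0).
  rewrite (_ : (fun t => _) = (fun t => h (r + s0 *: Om + t *: Om))).
    apply: hac; first by rewrite ltrD2r.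
    move=> t; rewrite ltrBlDr ltrBrDr -addrA -scalerDl addrC => tab.
    by rewrite addrC; apply: Dab; rewrite addrC.
  by apply/funext => t; rewrite scalerDl addrA.
have [[uac0 vac0] _] := good _ s0N (Dab _ s0ab).
have inflow := outward_normal_inflow oD nvP ab bra Dab.
apply: (@energy_inequality_1d _ a b E (fun s => sig (r + s *: Om))
   (fun s => (q1 (r + s *: Om) - q2 (r + s *: Om)) ^+ 2 / sig (r + s *: Om))).
- exact: ltW.
- by apply: abs_continuousB; apply: ac_ab.
- by rewrite /E ubd// vbd// subrr.
- exact: (measurable_line mD Dab' mE (measurable_itv _)).
- exact: (measurable_line mD Dab' mG (measurable_itv _)).
- move=> s /=; rewrite in_itv/= => /Dab Ds; split; first exact/ltW/sig0.
  exact: G0.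
- have [A [mA A0 NA]] := aer.
  exists A; split; [exact: mA|exact: A0|move=> s Hs; apply: NA => /= sN; apply: Hs].
  move=> sab; have Ds := Dab _ sab.
  have [_ [[du equ] [dv eqv]]] := good _ sN Ds.
  have [dU eU] := derive_line du; have [dV eV] := derive_line dv.
  have iU : is_derive s (1 : R) (fun t => u (r + t *: Om)) ('D_Om u (r + s *: Om)).
    by rewrite -eU derive1E; exact: derivableP.
  have iV : is_derive s (1 : R) (fun t => v (r + t *: Om)) ('D_Om v (r + s *: Om)).
    by rewrite -eV derive1E; exact: derivableP.
  have iE := is_deriveB iU iV.
  have -> : derive1 E s = 'D_Om u (r + s *: Om) - 'D_Om v (r + s *: Om).
    by rewrite derive1E; exact: (@derive_val _ _ _ _ _ _ _ iE).
  split; first exact: (@ex_derive _ _ _ _ _ _ _ iE).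
  rewrite -equ -eqv /E; move: (sig0 _ Ds).
  move: (sig _) (u _) (v _) ('D_Om u _) ('D_Om v _) => S U W dU' dW' S0.
  rewrite -subr_ge0.
  (* The defect in the differential inequality is the square [(E')^2 / sig]. *)
  have -> : (dU' + S * U - (dW' + S * W)) ^+ 2 / S -
      (2 * (U - W) * (dU' - dW') + S * (U - W) ^+ 2) = (dU' - dW') ^+ 2 / S.
    by field; rewrite gt_eqF.
  by rewrite mulr_ge0 ?sqr_ge0// invr_ge0 ltW.
Qed.

End TransportEnergy.
(** * Random transversals of a partition *)

Section TransversalMoments.
Context {R : realType} {I : finType}.
Variables (x0 : I) (P : {set {set I}}) (p : I -> R).
Hypothesis partP : finset.partition P [set: I]%SET.
Hypothesis p1 : forall g, g \in P -> \sum_(k in g) p k = 1.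

Notation transv A := (finset.is_transversal A P [set: I]%SET).
Notation sections := (pfamily x0 [pred g | g \in P] (fun g : {set I} => [pred k | k \in g])).

Lemma sectionP (f : {ffun {set I} -> I}) : f \in sections ->
  forall g, g \in P -> f g \in g.
Proof. by move=> /pfamilyP[_ fP] g /fP; rewrite inE. Qed.

Lemma section_inj (f : {ffun {set I} -> I}) : f \in sections ->
  {in P &, injective f}.
Proof.
move=> /sectionP fP g h gP hP fgh.
have /and3P[_ tP _] := partP.
rewrite -(finset.def_pblock tP gP (fP g gP)) fgh.
exact: finset.def_pblock tP hP (fP h hP).
Qed.

Lemma section_transversal (f : {ffun {set I} -> I}) : f \in sections ->
  transv (f @: P).
Proof.
move=> fS; have fP := sectionP fS; have /and3P[_ tP _] := partP.
apply/and3P; split; [exact: partP|exact: finset.subsetT|].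
apply/forall_inP => g gP; apply/cards1P; exists (f g).
apply/finset.setP => k; rewrite !inE; apply/andP/eqP => [[/imsetP[h hP ->] fhg]|->].
  have <- // : h = g.
  by rewrite -(finset.def_pblock tP hP (fP h hP)) (finset.def_pblock tP gP fhg).
by split; [exact: imset_f|exact: fP].
Qed.

(** A transversal is the image of exactly one choice function on the blocks; prescribing the value
    [x0] off [P] makes it unique. *)
Lemma sum_transversals (F : {set I} -> R) :
  \sum_(A : {set I} | transv A) F A =
  \sum_(f in sections) F (f @: P).
Proof.
pose h' (A : {set I}) : {ffun {set I} -> I} :=
  [ffun g => if g \in P then finset.transversal_repr x0 A g else x0].
rewrite (reindex_onto (fun f : {ffun {set I} -> I} => f @: P) h') /=.
  apply: eq_bigl => f; apply/andP/idP => [[tf /eqP <-]|fS].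
    apply/pfamilyP; split.
      apply/fintype.subsetP => g; rewrite !inE ffunE; case: ifP => // _.
      by rewrite eqxx.
    by move=> g; rewrite !inE ffunE => gP; rewrite gP (finset.repr_mem_pblock tf).
  have tf := section_transversal fS; split => //; apply/eqP/ffunP => g; rewrite ffunE.
  case: ifPn => [gP|gP]; last first.
    have /pfamilyP[/fintype.subsetP/(_ g)] := fS; rewrite !inE => H _.
    by apply/esym/eqP; apply: contraNT gP => /H.
  have : f g \in f @: P :&: g.
    by rewrite inE imset_f//= (sectionP fS).
  by rewrite (finset.setI_transversal_pblock tf x0 gP) inE => /eqP.
move=> A tA; rewrite -[RHS](finset.im_transversal_repr tA x0).
by apply: eq_in_imset => g gP; rewrite ffunE gP.
Qed.

Lemma big_transversal (S : Type) (idx : S) (op : Monoid.com_law idx) (F : I -> S)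
    (f : {ffun {set I} -> I}) : f \in sections ->
  \big[op/idx]_(k in f @: P) F k = \big[op/idx]_(g in P) F (f g).
Proof. by move=> fS; rewrite big_imset//; exact: section_inj. Qed.

Notation weight f := (\prod_(g in P) p (f g)).

(** Expanding a product of sums over the blocks enumerates the choice functions: independence across
    groups in algebraic form. *)
Lemma sum_sections_prod (b : {set I} -> I -> R) :
  \sum_(f in sections) weight f * \prod_(g in P) b g (f g) =
  \prod_(g in P) \sum_(k in g) p k * b g k.
Proof.
rewrite (big_distr_big_dep x0); apply: eq_bigr => f fS.
by rewrite -big_split.
Qed.

Lemma sum_sections1 : \sum_(f in sections) weight f = 1.
Proof.
transitivity (\prod_(g in P) \sum_(k in g) p k * 1).
  rewrite -(sum_sections_prod (fun _ _ => 1)); apply: eq_bigr => f _.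
  by rewrite big1_eq mulr1.
by rewrite big1// => g gP; under eq_bigr do rewrite mulr1; exact: p1.
Qed.

(** The marginal law in one group, obtained from the product formula with the factor [b] at [g] and
    1 elsewhere. *)
Lemma sum_sections_eval g (b : I -> R) : g \in P ->
  \sum_(f in sections) weight f * b (f g) = \sum_(k in g) p k * b k.
Proof.
move=> gP; pose c h k := if h == g then b k else 1.
transitivity (\sum_(f in sections) weight f * \prod_(h in P) c h (f h)).
  apply: eq_bigr => f _; congr (_ * _); rewrite (bigD1 g)//= {1}/c eqxx big1 ?mulr1//.
  by move=> h /andP[_ /negbTE hg]; rewrite /c hg.
rewrite sum_sections_prod (bigD1 g)//= [X in _ * X]big1 ?mulr1.
  by apply: eq_bigr => k _; rewrite /c eqxx.
move=> h /andP[hP /negbTE hg]; rewrite -(p1 hP); apply: eq_bigr => k _.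
by rewrite /c hg mulr1.
Qed.

(** The joint law of two groups, by the same device with two nontrivial factors. *)
Lemma sum_sections_eval2 g h (b c : I -> R) : g \in P -> h \in P -> g != h ->
  \sum_(f in sections) weight f * (b (f g) * c (f h)) =
  (\sum_(k in g) p k * b k) * (\sum_(k in h) p k * c k).
Proof.
move=> gP hP gh; pose d e k := if e == g then b k else if e == h then c k else 1.
have hg : (h == g) = false by apply/negbTE; rewrite eq_sym.
have dg k : d g k = b k by rewrite /d eqxx.
have dh k : d h k = c k by rewrite /d hg eqxx.
have d1 e k : e != g -> e != h -> d e k = 1.
  by move=> /negbTE eg /negbTE eh; rewrite /d eg eh.
have hPg : (h \in P) && (h != g) by rewrite hP hg.
transitivity (\sum_(f in sections) weight f * \prod_(e in P) d e (f e)).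
  apply: eq_bigr => f _; congr (_ * _); rewrite (bigD1 g)//= (bigD1 h)//= dg dh big1 ?mulr1//.
  by move=> e /andP[/andP[_ eg] eh]; rewrite d1.
rewrite sum_sections_prod (bigD1 g)//= (bigD1 h)//= [X in _ * (_ * X)]big1 ?mulr1.
  by congr (_ * _); apply: eq_bigr => k _; rewrite ?dg ?dh.
move=> e /andP[/andP[eP eg] eh]; rewrite -(p1 eP).
by apply: eq_bigr => k _; rewrite d1// mulr1.
Qed.

(** With [Y] centred in each group, [C] the bias: the terms linear in [Y] have mean zero, and
    products from distinct groups vanish by independence, so only the variances within the groups
    and [C ^+ 2] survive. *)
Lemma transversal_second_moment (x : I -> R) (c : R) :
  \sum_(A : {set I} | transv A) (\prod_(k in A) p k) * (\sum_(k in A) x k - c) ^+ 2 =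
  \sum_(g in P) (\sum_(k in g) p k * x k ^+ 2 - (\sum_(k in g) p k * x k) ^+ 2) +
  (\sum_k p k * x k - c) ^+ 2.
Proof.
pose m (g : {set I}) := \sum_(k in g) p k * x k.
pose Y (g : {set I}) k := x k - m g.
have EY g : g \in P -> \sum_(k in g) p k * Y g k = 0.
  move=> gP; under eq_bigr do rewrite mulrBr.
  by rewrite sumrB -mulr_suml p1// mul1r subrr.
have EY2 g : g \in P -> \sum_(k in g) p k * Y g k ^+ 2 =
    \sum_(k in g) p k * x k ^+ 2 - m g ^+ 2.
  move=> gP; transitivity (\sum_(k in g) (p k * x k ^+ 2 - (2 * m g) * (p k * x k) +
      m g ^+ 2 * p k)).
    by apply: eq_bigr => k _; rewrite /Y; ring.
  rewrite big_split/= sumrB -!mulr_sumr p1// -/(m g); ring.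
rewrite sum_transversals.
set C := \sum_(k : I) _ - c.
have Cm : C = \sum_(g in P) m g - c.
  congr (_ - c); rewrite /m -(finset.set_partition_big _ partP).
  by apply: eq_bigl => k; rewrite inE.
transitivity (\sum_(f in sections) (\sum_(g in P) \sum_(h in P)
    weight f * (Y g (f g) * Y h (f h)) +
    (2 * C) * \sum_(g in P) weight f * Y g (f g) + weight f * C ^+ 2)).
  apply: eq_bigr => f fS; rewrite !big_transversal//.
  have -> : \sum_(g in P) x (f g) - c = \sum_(g in P) Y g (f g) + C.
    rewrite Cm addrA; congr (_ - c); rewrite -big_split; apply: eq_bigr => g _ /=.
    by rewrite /Y subrK.
  have -> : \sum_(g in P) \sum_(h in P) weight f * (Y g (f g) * Y h (f h)) =
      weight f * (\sum_(g in P) Y g (f g)) ^+ 2.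
    rewrite expr2 mulr_suml mulr_sumr; apply: eq_bigr => g _.
    by rewrite !mulr_sumr.
  rewrite -mulr_sumr.
  ring.
rewrite !big_split/= -mulr_suml sum_sections1 mul1r -mulr_sumr; congr (_ + _).
rewrite [X in _ + _ * X]exchange_big/= [X in _ + _ * X]big1 ?mulr0 ?addr0; last first.
  by move=> g gP; rewrite (sum_sections_eval (Y g))// EY.
rewrite exchange_big/= -[RHS]big_split/=; apply: eq_bigr => g gP.
rewrite exchange_big/= (bigD1 g)//= [X in _ + X]big1 ?addr0.
  rewrite -EY2// -(sum_sections_eval (fun k => Y g k ^+ 2))//.
by move=> h /andP[hP hg]; rewrite (sum_sections_eval2 (Y g) (Y h))// 1?eq_sym// EY// mul0r.
Qed.

End TransversalMoments.

(** The factor [sqrt (p * q)] comes out of both terms; this exposes the integrand of [rsi_M] as a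
    sum of weighted squared differences. *)
Lemma sqrt_ratio_weighted (R : realType) (p q a b : R) : 0 < p -> 0 < q ->
  (Num.sqrt (q / p) * a - Num.sqrt (p / q) * b) ^+ 2 = p * q * (a / p - b / q) ^+ 2.
Proof.
move=> p0 q0.
have -> : Num.sqrt (q / p) * a = Num.sqrt (p * q) * (a / p).
  rewrite (_ : q / p = p * q * p^-1 ^+ 2); last by field; rewrite gt_eqF.
  rewrite sqrtrM ?mulr_ge0 ?ltW// sqrtr_sqr gtr0_norm ?invr_gt0//.
  by rewrite -mulrA [_^-1 * _]mulrC.
have -> : Num.sqrt (p / q) * b = Num.sqrt (p * q) * (b / q).
  rewrite (_ : p / q = p * q * q^-1 ^+ 2); last by field; rewrite gt_eqF.
  rewrite sqrtrM ?mulr_ge0 ?ltW// sqrtr_sqr gtr0_norm ?invr_gt0//.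
  by rewrite -mulrA [_^-1 * _]mulrC.
by rewrite -mulrBr exprMn sqr_sqrtr// mulr_ge0// ltW.
Qed.

(** With [x = a / p] the estimator is unbiased, as [p * x = a], and a variance is half the mean
    squared difference of two independent copies: [1/2 sum p p' (x - x')^2]. *)
Lemma transversal_variance (R : realType) (I : finType) (x0 : I) (P : {set {set I}})
    (p a : I -> R) (c : R) :
  finset.partition P [set: I]%SET -> (forall k, 0 < p k) ->
  (forall g, g \in P -> \sum_(k in g) p k = 1) ->
  \sum_(A : {set I} | finset.is_transversal A P [set: I]%SET)
    (\prod_(k in A) p k) * (\sum_(k in A) a k / p k - c) ^+ 2 =
  2^-1 * (\sum_(g in P) \sum_(k in g) \sum_(k' in g)
    (Num.sqrt (p k' / p k) * a k - Num.sqrt (p k / p k') * a k') ^+ 2) +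
  (\sum_k a k - c) ^+ 2.
Proof.
move=> partP p0 p1.
rewrite (transversal_second_moment x0 partP p1); congr (_ + _); last first.
  by congr ((_ - _) ^+ 2); apply: eq_bigr => k _; rewrite mulrC divfK// gt_eqF.
rewrite mulr_sumr; apply: eq_bigr => g gP.
transitivity (2^-1 * \sum_(k in g) \sum_(k' in g)
   (p k * (a k / p k) ^+ 2 * p k' - 2 * (p k * (a k / p k)) * (p k' * (a k' / p k')) +
    p k * (p k' * (a k' / p k') ^+ 2))); last first.
  congr (_ * _); apply: eq_bigr => k _; apply: eq_bigr => k' _.
  by rewrite sqrt_ratio_weighted//; ring.
set s2 := \sum_(k in g) p k * (a k / p k) ^+ 2.
set s1 := \sum_(k in g) p k * (a k / p k).
transitivity (2^-1 * \sum_(k in g) (p k * (a k / p k) ^+ 2 - 2 * (p k * (a k / p k)) * s1 +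
    p k * s2)); last first.
  congr (_ * _); apply: eq_bigr => k _.
  by rewrite big_split/= sumrB -!mulr_sumr p1// mulr1.
rewrite big_split/= sumrB -!mulr_suml -mulr_sumr -/s1 -/s2 p1//; by field.
Qed.
(** * The selection process *)

Section FiniteValued.
Context d (T : measurableType d) {R : realType} (mu : {measure set T -> \bar R}).
Context {H : finType} (X : T -> H).
Hypothesis mX : forall h, measurable [set t | X t = h].

Lemma fin_valuedE (F : H -> \bar R) t :
  F (X t) = (\sum_h F h * (\1_[set t | X t = h] t)%:E)%E.
Proof.
rewrite (bigD1 (X t))//= indicE mem_set//= mule1 big1 ?adde0// => h hX.
by rewrite indicE memNset ?mule0//= => Xt; rewrite Xt eqxx in hX.
Qed.

Lemma measurable_fin_valued (F : H -> \bar R) :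
  measurable_fun setT (fun t => F (X t)).
Proof.
under eq_fun do rewrite fin_valuedE.
apply: emeasurable_sum => h; apply: emeasurable_funM => //.
apply/measurable_EFinP; exact: measurable_indic.
Qed.

Lemma integral_fin_valued (F : H -> \bar R) : (forall h, 0 <= F h)%E ->
  (\int[mu]_t F (X t) = \sum_h F h * mu [set t | X t = h])%E.
Proof.
move=> F0; under eq_integral do rewrite fin_valuedE.
rewrite ge0_integral_sum//.
- apply: eq_bigr => h _; rewrite ge0_integralZl//.
  + by rewrite integral_indic// setIT.
  + by apply/measurable_EFinP; exact: measurable_indic.
- move=> h; apply: emeasurable_funM => //.
  by apply/measurable_EFinP; exact: measurable_indic.
- by move=> h t _; rewrite mule_ge0// lee_fin.
Qed.

(* The junk value 0 is taken outside the range of [X]. *)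
Definition factor (f : T -> \bar R) (h : H) : \bar R :=
  if pselect (exists t, X t = h) is left e then f (projT1 (cid e)) else 0%E.

Lemma factorE (f : T -> \bar R) : (forall t t', X t = X t' -> f t = f t') ->
  f = fun t => factor f (X t).
Proof.
move=> fX; apply/funext => t; rewrite /factor; case: pselect => [e|]; last first.
  by case; exists t.
by apply: fX; rewrite (projT2 (cid e)).
Qed.

Lemma factor_ge0 (f : T -> \bar R) h : (forall t, 0 <= f t)%E -> (0 <= factor f h)%E.
Proof. by move=> f0; rewrite /factor; case: pselect. Qed.

End FiniteValued.

Section Selection.
Context {R : realType} {M : nat} (w : 'I_M -> R) (K : 'I_M -> 'I_M -> R).
Context (P : {set {set 'I_M}}) d (T : measurableType d) (Pr : probability T R).
Context (V : nat -> T -> {set 'I_M}).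
Hypothesis hV : rsi_selection w K P Pr V.

(** Valued in a finite type, so that conditioning on the past splits the probability space into
    finitely many events. *)
Definition history n (t : T) : {ffun 'I_n.+1 -> {set 'I_M}} := [ffun i => V (val i) t].

Lemma historyP n t (h : {ffun 'I_n.+1 -> {set 'I_M}}) :
  history n t = h <-> (forall i : 'I_n.+1, V i t = h i).
Proof.
split=> [<- i|Vh]; first by rewrite ffunE.
by apply/ffunP => i; rewrite ffunE; exact: Vh.
Qed.

Lemma history_eq n t t' : history n t = history n t' <->
  (forall i, (i <= n)%N -> V i t = V i t').
Proof.
rewrite historyP; split => [Vt i|Vt i]; last by rewrite ffunE Vt// -ltnS.
by rewrite -ltnS => ilt; have := Vt (Ordinal ilt); rewrite ffunE.
Qed.

Lemma measurable_history n h : measurable [set t | history n t = h].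
Proof.
rewrite (_ : [set t | _] = \bigcap_(i in [set: 'I_n.+1]) [set t | V i t = h i]).
  apply: fin_bigcap_measurable => // i _; exact: (sel_measurable hV).
apply/seteqP; split => t /= Ht; first by move=> i _; exact: (historyP t h).1 Ht i.
by apply/historyP => i; exact: Ht.
Qed.

(** The source of all measurability in the sample point: a function of the history takes finitely
    many values, on measurable events. *)
Lemma measurable_history_dep n (f : T -> \bar R) :
  (forall t t', history n t = history n t' -> f t = f t') ->
  measurable_fun setT f.
Proof.
move=> fh; rewrite (factorE fh); apply: measurable_fin_valued.
exact: measurable_history.
Qed.

Lemma history_selection_prob n (h : {ffun 'I_n.+1 -> {set 'I_M}}) A :
  Pr [set t | history n t = h /\ V n.+1 t = A] =
  (if finset.is_transversal A P [set: 'I_M]%SET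
   then Pr [set t | history n t = h] * (\prod_(k in A) rsi_prob w K P (h ord_max) k)%:E
   else 0)%E.
Proof.
have empty (S : set T) : S `<=` set0 -> Pr S = 0%E by rewrite subset0 => ->; rewrite measure0.
case: ifPn => trA; last first.
  by apply: empty => t /= [_ VA]; move: trA; rewrite -VA (sel_transversal hV).
have [trh|] := pselect (forall i, finset.is_transversal (h i) P [set: 'I_M]%SET); last first.
  move=> /existsNP[i hi]; rewrite !empty ?mul0e// => t /=.
    by move=> /historyP/(_ i) Vi; apply: hi; rewrite -Vi (sel_transversal hV).
  by move=> [/historyP/(_ i) Vi _]; apply: hi; rewrite -Vi (sel_transversal hV).
(* [sel_step] wants an infinite sequence of transversals: the finite history is continued by the
   constant [A]. *)
pose h' i := if (i <= n)%N then h (inord i) else A.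
have h'E (i : 'I_n.+1) : h' i = h i by rewrite /h' -ltnS ltn_ord inord_val.
have := sel_step hV n (h := h').
have h'tr i : finset.is_transversal (h' i) P [set: 'I_M]%SET.
  by rewrite /h'; case: ifP.
move=> /(_ h'tr).
have -> : [set t | forall i, (i <= n.+1)%N -> V i t = h' i] =
    [set t | history n t = h /\ V n.+1 t = A].
  apply/seteqP; split => t /=.
    move=> Vh; split.
      by apply/historyP => i; rewrite -h'E; apply: Vh; rewrite ltnW// ltn_ord.
    by rewrite (Vh n.+1)// /h' ltnn.
  move=> [/historyP Vh VA] i; rewrite leq_eqVlt => /predU1P[->|ilt].
    by rewrite /h' ltnn.
  by rewrite -[i]/(val (Ordinal ilt)) h'E; exact: Vh.
have -> : [set t | forall i, (i <= n)%N -> V i t = h' i] = [set t | history n t = h].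
  apply/seteqP; split => t /=.
    by move=> Vh; apply/historyP => i; rewrite -h'E; apply: Vh; rewrite -ltnS ltn_ord.
  move=> /historyP Vh i; rewrite -ltnS => ilt.
  by rewrite -[i]/(val (Ordinal ilt)) h'E; exact: Vh.
have -> : h' n.+1 = A by rewrite /h' ltnn.
by have -> : h' n = h ord_max by exact: (h'E ord_max).
Qed.

(** The tower property: [F] is frozen by the history, and the last selection is averaged under its
    conditional law. The whole history is kept, not only [V n], because the iterates depend on all
    past selections. *)
Lemma integral_selection n (F : T -> {set 'I_M} -> \bar R) :
  (forall t A, 0 <= F t A)%E ->
  (forall t t' A, history n t = history n t' -> F t A = F t' A) ->
  (forall t k, 0 <= rsi_prob w K P (V n t) k) ->
  (\int[Pr]_t F t (V n.+1 t) =
   \int[Pr]_t \sum_(A : {set 'I_M} | finset.is_transversal A P [set: 'I_M]%SET)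
     (\prod_(k in A) rsi_prob w K P (V n t) k)%:E * F t A)%E.
Proof.
move=> F0 FH p0.
pose F' h A := factor (history n) (F ^~ A) h.
have F'0 h A : (0 <= F' h A)%E by exact: factor_ge0.
have FE t A : F t A = F' (history n t) A.
  by rewrite [LHS](congr1 (@^~ t) (factorE (fun t t' => FH t t' A))).
pose X t := (history n t, V n.+1 t).
have XE h A : [set t | X t = (h, A)] = [set t | history n t = h /\ V n.+1 t = A].
  by apply/seteqP; split => t /=; rewrite /X; [case=> -> ->|case=> -> ->].
have mX hA : measurable [set t | X t = hA].
  case: hA => h A; rewrite XE; apply: measurableI; first exact: measurable_history.
  exact: (sel_measurable hV).
have -> : (\int[Pr]_t F t (V n.+1 t) =
    \sum_hA F' hA.1 hA.2 * Pr [set t | X t = hA])%E.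
  rewrite -(@integral_fin_valued _ _ _ Pr _ _ mX (fun hA => F' hA.1 hA.2)).
    by apply: eq_integral => t _; rewrite FE.
  by move=> [h A]; exact: F'0.
transitivity (\sum_h \sum_A F' h A * Pr [set t | X t = (h, A)])%E.
  by rewrite pair_bigA; apply: eq_bigr => -[h A].
pose G t := (\sum_(A : {set 'I_M} | finset.is_transversal A P [set: 'I_M]%SET)
  (\prod_(k in A) rsi_prob w K P (V n t) k)%:E * F t A)%E.
have G0 t : (0 <= G t)%E.
  by apply: sume_ge0 => A _; rewrite mule_ge0// lee_fin prodr_ge0.
have GH t t' : history n t = history n t' -> G t = G t'.
  move=> tt'; apply: eq_bigr => A _; rewrite (FH _ _ _ tt').
  by have /history_eq/(_ n (leqnn n)) -> := tt'.
transitivity (\int[Pr]_t factor (history n) G (history n t))%E; last first.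
  by rewrite -(factorE GH).
rewrite (@integral_fin_valued _ _ _ Pr _ _ (@measurable_history n)); last first.
  by move=> h; exact: factor_ge0.
apply: eq_bigr => h _.
(* A history that never occurs contributes zero to both sides; any other is represented by a sample
   point [t]. *)
have [[t th]|nth] := pselect (exists t, history n t = h); last first.
  have -> : [set t | history n t = h] = set0.
    by apply/seteqP; split => // t /= th; apply: nth; exists t.
  rewrite measure0 mule0 big1// => A _.
  rewrite XE (_ : [set t | _] = set0) ?measure0 ?mule0//.
  by apply/seteqP; split => // t /= [th _]; apply: nth; exists t.
rewrite -th -(congr1 (@^~ t) (factorE GH)) th.
rewrite /G ge0_sume_distrl; last by move=> A _; rewrite mule_ge0// lee_fin prodr_ge0.
rewrite [RHS]big_mkcond; apply: eq_bigr => A _; rewrite XE history_selection_prob.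
case: ifP => _; last by rewrite mule0.
rewrite FE th; have -> : h ord_max = V n t by rewrite -th ffunE.
by rewrite [X in (_ * X)%E]muleC muleA; congr (_ * _)%E; rewrite muleC.
Qed.

End Selection.

(** * The weighted energy of functions on the domain *)

Section WeightedEnergy.
Context {R : realType}.
Notation RT := (measurableTypeR R).
Notation R3 := (RT * RT * RT)%type.
Context (D : set (point3 R)) (sig : point3 R -> R).
Hypotheses (mD : measurable (D : set R3)) (msig : measurable_fun D sig).
Hypothesis sig0 : forall r, D r -> 0 < sig r.

Implicit Types u v : point3 R -> R.

Definition energy (u : point3 R -> R) : \bar R :=
  (\int[leb3]_(r in D) (sig r * u r ^+ 2)%:E)%E.

Lemma energy_ge0 u : (0 <= energy u)%E.
Proof.
by apply: integral_ge0 => r /sig0 s0; rewrite lee_fin mulr_ge0 ?sqr_ge0// ltW.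
Qed.

Lemma l2norm_sqr (u : point3 R -> R) :
  (l2norm D (fun r => Num.sqrt (sig r) * u r)%R ^+ 2)%E = energy u.
Proof.
rewrite /l2norm sqr_sqrte; last first.
  by apply: integral_ge0 => r _; rewrite lee_fin sqr_ge0.
apply: eq_integral => r; rewrite inE => Dr.
by rewrite exprMn sqr_sqrtr// ltW// sig0.
Qed.

Lemma measurable_energy_density u : measurable_fun D u ->
  measurable_fun D (fun r => (sig r * u r ^+ 2)%:E).
Proof.
by move=> mu_; apply/measurable_EFinP; apply: measurable_funM => //; exact: measurable_funX.
Qed.

Lemma energy_ae_eq u v : measurable_fun D u -> measurable_fun D v ->
  {ae leb3, forall r : R3, D r -> u r = v r} -> energy u = energy v.
Proof.
move=> mu_ mv uv; rewrite /energy leb3E.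
apply: ae_eq_integral => //.
- exact: measurable_energy_density.
- exact: measurable_energy_density.
have aeF := ae_filter_ringOfSetsType (@volume R).
by move: uv; apply: filterS => r uvr Dr; rewrite uvr.
Qed.

Lemma energy_eq0 u : measurable_fun D u -> energy u = 0%E ->
  {ae leb3, forall r : R3, D r -> u r = 0}.
Proof.
move=> mu_ u0.
have mf := measurable_energy_density mu_.
have : (\int[volume]_(r in D) `|(sig r * u r ^+ 2)%:E| = 0)%E.
  rewrite -[RHS]u0; apply: eq_integral => r; rewrite inE => /sig0 s0.
  by rewrite gee0_abs// lee_fin mulr_ge0 ?sqr_ge0// ltW.
move/(ae_eq_integral_abs (@volume R) mD); move/(_ mf).
have aeF := ae_filter_ringOfSetsType (@volume R).
apply: filterS => r /= + Dr => /(_ Dr) /eqP; rewrite eqe mulf_eq0.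
by rewrite gt_eqF ?sig0//= expf_eq0/= => /eqP.
Qed.

Lemma energyZ c u : measurable_fun D u ->
  energy (fun r => c * u r) = ((c ^+ 2)%:E * energy u)%E.
Proof.
move=> mu_; rewrite /energy leb3E -ge0_integralZl//.
- by apply: eq_integral => r _; rewrite -EFinM; congr _%:E; ring.
- exact: measurable_energy_density.
- by move=> r /sig0 s0; rewrite lee_fin mulr_ge0 ?sqr_ge0// ltW.
- by rewrite lee_fin sqr_ge0.
Qed.

(** Brings sums over directions or transversals under the integral, where identities and
    inequalities are used pointwise in space. *)
Lemma weighted_energy_sum (I : Type) (s : seq I) (c : I -> R)
    (u : I -> point3 R -> R) :
  (forall i, 0 <= c i) -> (forall i, measurable_fun D (u i)) ->
  (\sum_(i <- s) (c i)%:E * energy (u i) =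
   \int[leb3]_(r in D) (sig r * \sum_(i <- s) c i * u i r ^+ 2)%:E)%E.
Proof.
move=> c0 mu_.
transitivity (\sum_(i <- s) \int[volume]_(r in D) (c i * (sig r * u i r ^+ 2))%:E)%E.
  apply: eq_bigr => i _; rewrite -ge0_integralZl//.
  - exact: measurable_energy_density.
  - by move=> r /sig0 s0; rewrite lee_fin mulr_ge0 ?sqr_ge0// ltW.
  - by rewrite lee_fin c0.
rewrite -ge0_integral_sum//.
- by apply: eq_integral => r _; rewrite sumEFin mulr_sumr; congr _%:E;
    apply: eq_bigr => i _; ring.
- move=> i; apply/measurable_EFinP; apply: measurable_funM => //.
  apply: measurable_funM; first exact: msig.
  by apply: measurable_funX; exact: mu_.
- move=> i r /sig0 s0; rewrite lee_fin; apply: mulr_ge0; first exact: c0.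
  by apply: mulr_ge0; [exact: ltW|exact: sqr_ge0].
Qed.

End WeightedEnergy.

(** * Contraction of the transport solution operator *)

Section Contraction.
Context {R : realType}.
Notation RT := (measurableTypeR R).
Notation R3 := (RT * RT * RT)%type.

(** A point of [D] excludes the value [-oo] and the bound by 1 excludes [+oo], so [fine] loses
    nothing. *)
Lemma supnorm_ratio (D : set (point3 R)) (f : point3 R -> R) : D !=set0 ->
  (supnorm D f < 1)%E ->
  [/\ 0 <= fine (supnorm D f), fine (supnorm D f) < 1 &
      forall r, D r -> `|f r| <= fine (supnorm D f)].
Proof.
move=> [r0 Dr0] f1.
have fle r : D r -> (`|f r|%:E <= supnorm D f)%E.
  by move=> Dr; apply: ereal_sup_ubound; exists r.
have f0 : (0 <= supnorm D f)%E by rewrite (le_trans _ (fle _ Dr0))// lee_fin.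
have ffin : supnorm D f \is a fin_num.
  by rewrite ge0_fin_numE// (lt_trans f1)// ltry.
split; first exact: fine_ge0.
  by rewrite -lte_fin fineK.
by move=> r Dr; rewrite -lee_fin fineK// fle.
Qed.

Lemma transport_contraction (D : set (point3 R)) nv (Om : point3 R)
    (SigT SigS Q f1 f2 g u v : point3 R -> R) (rho : R) :
  bounded_convex_domain D -> outward_normal D nv -> dot Om Om = 1 ->
  measurable_fun D SigT -> measurable_fun D SigS -> (forall r, D r -> 0 < SigT r) ->
  (forall r, D r -> `|SigS r / SigT r| <= rho) ->
  measurable_fun D (fun r => f1 r - f2 r) ->
  transport_solution D nv Om SigT (fun r => SigS r * f1 r + Q r) g u ->
  transport_solution D nv Om SigT (fun r => SigS r * f2 r + Q r) g v ->
  (energy D SigT (fun r => u r - v r)%R <=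
   (rho ^+ 2)%:E * energy D SigT (fun r => f1 r - f2 r)%R)%E.
Proof.
move=> bcD nvP Om1 mT mS T0 rhoP mf solu solv.
have mD : measurable (D : set R3) by apply: open_measurable3; case: bcD.
have dq r : (SigS r * f1 r + Q r) - (SigS r * f2 r + Q r) = SigS r * (f1 r - f2 r).
  by ring.
have mq : measurable_fun D (fun r => (SigS r * f1 r + Q r) - (SigS r * f2 r + Q r)).
  by under eq_fun do rewrite dq; exact: measurable_funM.
apply: (le_trans (transport_energy bcD nvP Om1 mT T0 mq solu solv)).
rewrite -energyZ//.
apply: (@ge0_le_integral _ _ _ (@volume R)) => //.
- by move=> r /T0 t0; rewrite lee_fin mulr_ge0 ?sqr_ge0// invr_ge0 ltW.
- apply/measurable_EFinP; apply: measurable_funM; first exact: measurable_funX.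
  exact: measurable_fun_inv_pos.
- by apply: measurable_energy_density => //; exact: measurable_funM.
move=> r Dr; have t0 := T0 _ Dr; rewrite lee_fin dq.
have -> : (SigS r * (f1 r - f2 r)) ^+ 2 / SigT r =
    SigT r * ((SigS r / SigT r) ^+ 2 * (f1 r - f2 r) ^+ 2).
  by field; rewrite gt_eqF.
rewrite [X in _ <= _ * X]exprMn ler_wpM2l ?(ltW t0)// ler_wpM2r ?sqr_ge0//.
rewrite -[leLHS]real_normK ?num_real// lerXn2r ?nnegrE//; last exact: rhoP.
exact: le_trans (normr_ge0 _) (rhoP _ Dr).
Qed.

End Contraction.

(** * Finite sums, Jensen's inequality and discrete scattering *)

Section FiniteSums.
Context {R : realType}.
Notation RT := (measurableTypeR R).
Notation R3 := (RT * RT * RT)%type.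

Lemma measurable_sum_cond (I : finType) (B : pred I) (D : set (point3 R))
    (h : I -> point3 R -> R) : (forall k, measurable_fun D (h k)) ->
  measurable_fun D (fun r => \sum_(k | B k) h k r).
Proof.
move=> mh; rewrite (_ : (fun r => _) = fun r => \sum_(k <- [seq k <- index_enum I | B k]) h k r).
  exact: measurable_sum.
by apply/funext => r; rewrite big_filter.
Qed.

Lemma ae_forall_fin (I : finType) (B : I -> point3 R -> Prop) :
  (forall k, {ae leb3, forall r : R3, B k r}) ->
  {ae leb3, forall r : R3, forall k, B k r}.
Proof.
move=> aeB; have aeF := ae_filter_ringOfSetsType (@volume R).
exact: (@filter_forall R3 I B (almost_everywhere volume) aeF aeB).
Qed.

(** The difference of the two sides is the variance of [e] under the weights [c]. *)
Lemma jensen_sqr (I : finType) (c e : I -> R) : (forall k, 0 <= c k) ->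
  \sum_k c k = 1 -> (\sum_k c k * e k) ^+ 2 <= \sum_k c k * e k ^+ 2.
Proof.
move=> c0 c1; set m := \sum_k c k * e k; rewrite -subr_ge0.
have -> : \sum_k c k * e k ^+ 2 - m ^+ 2 = \sum_k c k * (e k - m) ^+ 2.
  transitivity (\sum_k (c k * e k ^+ 2 - 2 * m * (c k * e k) + m ^+ 2 * c k)).
    by rewrite big_split/= sumrB -!mulr_sumr c1 -/m; ring.
  by apply: eq_bigr => k _; ring.
by apply: sumr_ge0 => k _; rewrite mulr_ge0 ?sqr_ge0.
Qed.

(** The normalisation over [k] makes the weights in Jensen's inequality a probability; the one over
    [m] is used after exchanging the sums. *)
Lemma scattering_contraction (I : finType) (w : I -> R) (K : I -> I -> R) (e : I -> R) :
  (forall k, 0 <= w k) -> (forall k m, 0 <= K k m) ->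
  (forall m, \sum_k w k * K k m = 1) -> (forall k, \sum_m w m * K k m = 1) ->
  \sum_m w m * (\sum_k w k * K k m * e k) ^+ 2 <= \sum_k w k * e k ^+ 2.
Proof.
move=> w0 K0 Kl Kr.
apply: (@le_trans _ _ (\sum_m w m * \sum_k w k * K k m * e k ^+ 2)).
  apply: ler_sum => m _; rewrite ler_wpM2l//; apply: jensen_sqr => // k.
  exact: mulr_ge0.
under eq_bigr do rewrite mulr_sumr.
rewrite exchange_big/=; apply: ler_sum => k _.
rewrite -[leRHS]mulr1 -(Kr k) mulr_sumr; apply: ler_sum => m _.
by rewrite le_eqVlt; apply/orP; left; apply/eqP; ring.
Qed.

End FiniteSums.

(** * Positivity and normalisation of the selection probabilities *)

Section SelectionProbabilities.
Context {R : realType} {M : nat} (w : 'I_M -> R) (K : 'I_M -> 'I_M -> R).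
Hypotheses (w0 : forall k, 0 < w k) (K0 : forall k m, 0 < K k m).
Context (P : {set {set 'I_M}}) (A : {set 'I_M}).
Hypothesis trA : finset.is_transversal A P [set: 'I_M]%SET.

(** The transversal meets the group of [m], so the sum of positive terms is not empty. *)
Lemma rsi_c_gt0 m : 0 < rsi_c w K A m.
Proof.
have /and3P[/and3P[/eqP cP tP _] _ /forall_inP A1] := trA.
have mP : finset.pblock P m \in P by rewrite finset.pblock_mem// cP inE.
have /cards1P[k Ak] := A1 _ mP.
have kA : k \in A.
  have : k \in A :&: finset.pblock P m by rewrite Ak inE.
  by rewrite inE => /andP[].
rewrite /rsi_c (bigD1 k)//= ltr_pwDl ?mulr_gt0//.
by apply: sumr_ge0 => j _; rewrite ltW// mulr_gt0.
Qed.

Lemma rsi_prob_gt0 m : 0 < rsi_prob w K P A m.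
Proof.
have /and3P[/and3P[/eqP cP tP _] _ _] := trA.
have mm : m \in finset.pblock P m by rewrite finset.mem_pblock cP inE.
rewrite /rsi_prob divr_gt0//; first by rewrite mulr_gt0// rsi_c_gt0.
rewrite (bigD1 m)//= ltr_pwDl ?mulr_gt0 ?rsi_c_gt0//.
by apply: sumr_ge0 => j _; rewrite ltW// mulr_gt0// rsi_c_gt0.
Qed.

Lemma sum_rsi_prob g : g \in P -> \sum_(m in g) rsi_prob w K P A m = 1.
Proof.
move=> gP; have /and3P[/and3P[_ tP n0] _ _] := trA.
transitivity (\sum_(m in g) w m * rsi_c w K A m / \sum_(m' in g) w m' * rsi_c w K A m').
  by apply: eq_bigr => m mg; rewrite /rsi_prob (finset.def_pblock tP gP mg).
rewrite -mulr_suml divff// gt_eqF//.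
have /finset.set0Pn[m mg] : g != finset.set0 by apply: contraNneq n0 => <-.
rewrite (bigD1 m)//= ltr_pwDl ?mulr_gt0 ?rsi_c_gt0//.
by apply: sumr_ge0 => j _; rewrite ltW// mulr_gt0// rsi_c_gt0.
Qed.

End SelectionProbabilities.

(** * The recursion for the variances *)

Section VarianceRecursion.
Context {R : realType} {M : nat}.
Notation RT := (measurableTypeR R).
Notation R3 := (RT * RT * RT)%type.
Context (D : set (point3 R)) (nv : point3 R -> point3 R).
Hypotheses (hD : bounded_convex_domain D) (hnv : outward_normal D nv).
Context (Om : 'I_M -> point3 R) (w : 'I_M -> R) (K : 'I_M -> 'I_M -> R).
Hypotheses (hOm : forall m, dot (Om m) (Om m) = 1) (hw1 : \sum_(m < M) w m = 1)
  (hKl : forall m, \sum_(k < M) w k * K k m = 1)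
  (hKr : forall k, \sum_(m < M) w m * K k m = 1)
  (hw : forall k, 0 < w k) (hK : forall k m, 0 < K k m).
Context (SigT SigS Q : point3 R -> R) (psiG : point3 R -> point3 R -> R) (rho : R).
Hypotheses (mSigT : measurable_fun D SigT) (mSigS : measurable_fun D SigS)
  (hSigT : forall r, D r -> 0 < SigT r)
  (hrho : forall r, D r -> `|SigS r / SigT r| <= rho).
Context (psi : nat -> 'I_M -> point3 R -> R).
Hypotheses (mpsi0 : forall m, measurable_fun D (psi 0%N m))
  (hSI : source_iteration D nv Om w K SigT SigS Q psiG psi).
Context (P : {set {set 'I_M}}) (d : measure_display) (T : measurableType d)
  (Pr : probability T R) (V : nat -> T -> {set 'I_M}).
Hypothesis hV : rsi_selection w K P Pr V.
Context (psit : nat -> T -> 'I_M -> point3 R -> R).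
Hypothesis hRSI : random_source_iteration D nv Om w K SigT SigS Q psiG P V (psi 0%N) psit.

Notation phit := (rsi_phi w K P V psit).
Notation phi := (si_phi w K psi).
Notation en := (energy D SigT).

Let mD : measurable (D : set R3).
Proof. by apply: open_measurable3; case: hD. Qed.

Lemma measurable_psi n m : measurable_fun D (psi n m).
Proof. by case: n => [|n]; [exact: mpsi0|exact: (ts_measurable (hSI n m))]. Qed.

Lemma measurable_psit n t m : measurable_fun D (psit n t m).
Proof.
case: n => [|n]; last exact: (ts_measurable (rsi_step hRSI n t m)).
rewrite (_ : psit 0%N t m = psi 0%N m); first exact: mpsi0.
by apply/funext => r; exact: (rsi_init hRSI).
Qed.

Lemma measurable_phi n m : measurable_fun D (phi n m).
Proof.
apply: measurable_sum_cond => k.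
by apply: measurable_funM => //; exact: measurable_psi.
Qed.

Lemma measurable_phit n t m : measurable_fun D (phit n t m).
Proof.
by case: n => [|n]; apply: measurable_sum_cond => k; apply: measurable_funM => //;
  exact: measurable_psit.
Qed.

(* Nothing is assumed on the dependence of [psit] on the sample point, so its
   measurability comes from here: by uniqueness for the transport problem, [psit]
   depends, almost everywhere in [D], only on the finitely many past selections. *)
Lemma psit_history n t t' : (forall i, (i < n)%N -> V i t = V i t') ->
  forall m, {ae leb3, forall r : R3, D r -> psit n t m r = psit n t' m r}.
Proof.
have aeF := ae_filter_ringOfSetsType (@volume R).
elim: n t t' => [|n IH] t t' Vtt' m.
  by apply: (@aeW _ _ _ (@volume R)) => r _; rewrite !(rsi_init hRSI).
have Vn : V n t = V n t' by exact: Vtt'.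
(* For [n >= 1] the probabilities in [rsi_phi] at level [n] come from the selection at [n - 1]; at
   level 0 the predecessor is 0 again and group sizes take their place. *)
have Vn1 : V n.-1 t = V n.-1 t' by apply: Vtt'; exact: leq_ltn_trans (leq_pred n) _.
have phiE : {ae leb3, forall r : R3, D r -> phit n t m r - phit n t' m r = 0}.
  have IHt k := IH t t' (fun i ilt => Vtt' i (ltnW ilt)) k.
  move: (ae_forall_fin IHt); apply: filterS => r psiE Dr.
  apply/eqP; rewrite subr_eq0; apply/eqP.
  case: (n) Vn Vn1 psiE => [|n'] /= Vn Vn1 psiE; rewrite Vn;
    apply: eq_bigr => k _; rewrite ?psiE//.
  by rewrite /rsi_p/= Vn1.
have mphi : measurable_fun D (fun r => phit n t m r - phit n t' m r).
  by apply: measurable_funB; exact: measurable_phit.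
have mdiff : measurable_fun D (fun r => psit n.+1 t m r - psit n.+1 t' m r).
  by apply: measurable_funB; exact: measurable_psit.
have := transport_contraction hD hnv (hOm m) mSigT mSigS hSigT hrho mphi
  (rsi_step hRSI n t m) (rsi_step hRSI n t' m).
(* Scattering terms that agree almost everywhere have zero energy difference: the contraction
   estimate acts as a uniqueness theorem. *)
have -> : en (fun r => phit n t m r - phit n t' m r) = 0%E.
  rewrite (@energy_ae_eq _ D SigT mD mSigT _ (fun=> 0))//.
  by apply: integral0_eq => r _; rewrite expr0n mulr0.
rewrite mule0 => en_le0.
have en0 : en (fun r => psit n.+1 t m r - psit n.+1 t' m r) = 0%E.
  by apply/eqP; rewrite eq_le en_le0 energy_ge0.
have := energy_eq0 mD mSigT hSigT mdiff en0.
by apply: filterS => r H Dr; apply/eqP; rewrite -subr_eq0; apply/eqP; exact: H.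
Qed.

Lemma phit_history n t t' : history V n t = history V n t' ->
  forall m, {ae leb3, forall r : R3, D r -> phit n t m r = phit n t' m r}.
Proof.
have aeF := ae_filter_ringOfSetsType (@volume R).
move=> /history_eq Vtt' m.
have IHt k := psit_history (fun i (ilt : (i < n)%N) => Vtt' i (ltnW ilt)) k.
move: (ae_forall_fin IHt); apply: filterS => r psiE Dr.
have Vn : V n t = V n t' by exact: Vtt'.
have Vn1 : V n.-1 t = V n.-1 t' by apply: Vtt'; exact: leq_pred.
case: (n) Vn Vn1 psiE => [|n'] /= Vn Vn1 psiE; rewrite Vn;
  apply: eq_bigr => k _; rewrite ?psiE//.
by rewrite /rsi_p/= Vn1.
Qed.

Definition psi_error n t : \bar R :=
  (\sum_m (w m)%:E * en (fun r => psit n t m r - psi n m r)%R)%E.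

Definition phi_error n t : \bar R :=
  (\sum_m (w m)%:E * en (fun r => phit n t m r - phi n m r)%R)%E.

Lemma psi_error_ge0 n t : (0 <= psi_error n t)%E.
Proof. by apply: sume_ge0 => m _; rewrite mule_ge0 ?energy_ge0// lee_fin ltW. Qed.

Lemma phi_error_ge0 n t : (0 <= phi_error n t)%E.
Proof. by apply: sume_ge0 => m _; rewrite mule_ge0 ?energy_ge0// lee_fin ltW. Qed.

Lemma psi_varianceE n : psi_variance D w SigT Pr psi psit n = (\int[Pr]_t psi_error n t)%E.
Proof. by apply: eq_integral => t _; apply: eq_bigr => m _; rewrite l2norm_sqr. Qed.

Lemma phi_varianceE n :
  phi_variance D w K SigT P Pr V psi psit n = (\int[Pr]_t phi_error n t)%E.
Proof. by apply: eq_integral => t _; apply: eq_bigr => m _; rewrite l2norm_sqr. Qed.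

(** Almost everywhere equality of the iterates becomes exact equality of the energies. The index
    shift is essential: the iterate [n + 1] is fixed before the selection [n + 1] is drawn. *)
Lemma psi_error_history n t t' : history V n t = history V n t' ->
  psi_error n.+1 t = psi_error n.+1 t'.
Proof.
have aeF := ae_filter_ringOfSetsType (@volume R).
move=> /history_eq Vtt'; apply: eq_bigr => m _; congr (_ * _)%E.
apply: (energy_ae_eq mD mSigT).
- by apply: measurable_funB; [exact: measurable_psit|exact: measurable_psi].
- by apply: measurable_funB; [exact: measurable_psit|exact: measurable_psi].
have := @psit_history n.+1 t t' Vtt' m.
by apply: filterS => r H Dr; rewrite H.
Qed.

Lemma phi_error_history n t t' : history V n t = history V n t' ->
  phi_error n t = phi_error n t'.
Proof.
have aeF := ae_filter_ringOfSetsType (@volume R).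
move=> Vtt'; apply: eq_bigr => m _; congr (_ * _)%E.
apply: (energy_ae_eq mD mSigT).
- by apply: measurable_funB; [exact: measurable_phit|exact: measurable_phi].
- by apply: measurable_funB; [exact: measurable_phit|exact: measurable_phi].
have := phit_history Vtt' m.
by apply: filterS => r H Dr; rewrite H.
Qed.

Lemma psi_error_step n t :
  (psi_error n.+1 t <= (rho ^+ 2)%:E * phi_error n t)%E.
Proof.
rewrite /phi_error ge0_sume_distrr; last first.
  by move=> m _; rewrite mule_ge0 ?energy_ge0// lee_fin ltW.
apply: lee_sum => m _; rewrite muleCA lee_wpmul2l ?lee_fin ?(ltW (hw m))//.
apply: (transport_contraction hD hnv (hOm m) mSigT mSigS hSigT hrho _
  (rsi_step hRSI n t m) (hSI n m)).
by apply: measurable_funB; [exact: measurable_phit|exact: measurable_phi].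
Qed.

Lemma psi_variance_step n :
  (psi_variance D w SigT Pr psi psit n.+1 <=
   (rho ^+ 2)%:E * phi_variance D w K SigT P Pr V psi psit n)%E.
Proof.
have mphiE := measurable_history_dep hV (@phi_error_history n).
rewrite psi_varianceE phi_varianceE -ge0_integralZl//; last 2 first.
- by move=> t _; exact: phi_error_ge0.
- by rewrite lee_fin sqr_ge0.
apply: ge0_le_integral => //.
- by move=> t _; exact: psi_error_ge0.
- exact: (measurable_history_dep hV (@psi_error_history n)).
- exact: measurable_funeM.
- by move=> t _; exact: psi_error_step.
Qed.

Hypothesis partP : finset.partition P [set: 'I_M]%SET.

Definition group_spread n t m (r : point3 R) : R :=
  \sum_(g in P) \sum_(k in g) \sum_(k' in g)
    (Num.sqrt (rsi_p w K P V n t k' / rsi_p w K P V n t k) * (w k * K k m * psit n t k r)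
     - Num.sqrt (rsi_p w K P V n t k / rsi_p w K P V n t k') *
       (w k' * K k' m * psit n t k' r)) ^+ 2.

(** The random variable whose expectation is [rsi_M n m]. *)
Definition sampling_variance n t m : \bar R :=
  ((2^-1 : R)%:E * \int[leb3]_(r in D) (SigT r * group_spread n t m r)%:E)%E.

Lemma group_spread_ge0 n t m r : 0 <= group_spread n t m r.
Proof.
apply: sumr_ge0 => g _; apply: sumr_ge0 => k _; apply: sumr_ge0 => k' _.
exact: sqr_ge0.
Qed.

Lemma measurable_group_spread n t m : measurable_fun D (group_spread n t m).
Proof.
apply: measurable_sum_cond => g; apply: measurable_sum_cond => k.
apply: measurable_sum_cond => k'; apply: measurable_funX.
by apply: measurable_funB; apply: measurable_funM => //; apply: measurable_funM => //;
  exact: measurable_psit.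
Qed.

Lemma measurable_spread_density n t m :
  measurable_fun D (fun r => (SigT r * group_spread n t m r)%:E).
Proof.
by apply/measurable_EFinP; apply: measurable_funM => //; exact: measurable_group_spread.
Qed.

Lemma spread_density_ge0 n t m r : D r -> (0 <= (SigT r * group_spread n t m r)%:E)%E.
Proof. by move=> /hSigT s0; rewrite lee_fin mulr_ge0 ?group_spread_ge0// ltW. Qed.

Lemma sampling_variance_ge0 n t m : (0 <= sampling_variance n t m)%E.
Proof.
rewrite /sampling_variance mule_ge0//; apply: integral_ge0 => r.
exact: spread_density_ge0.
Qed.

Lemma sampling_variance_history n t t' m : history V n t = history V n t' ->
  sampling_variance n.+1 t m = sampling_variance n.+1 t' m.
Proof.
have aeF := ae_filter_ringOfSetsType (@volume R).
move=> /history_eq Vtt'; congr (_ * _)%E.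
apply: (@ae_eq_integral _ _ _ (@volume R)) => //.
- exact: measurable_spread_density.
- exact: measurable_spread_density.
have IHt k := @psit_history n.+1 t t' Vtt' k.
move: (ae_forall_fin IHt); apply: filterS => r psiE Dr; congr ((_ * _)%:E).
apply: eq_bigr => g _; apply: eq_bigr => k _; apply: eq_bigr => k' _.
by rewrite !psiE// /rsi_p/= Vtt'.
Qed.

Let prob_gt0 n t k : 0 < rsi_prob w K P (V n t) k.
Proof. by apply: rsi_prob_gt0 => //; exact: (sel_transversal hV). Qed.

(** The error of the sampled scattering term with the past frozen and the new selection [A] left
    free, in the form to which [integral_selection] applies. *)
Definition selected_error n t (A : {set 'I_M}) : \bar R :=
  (\sum_m (w m)%:E * en (fun r => \sum_(k in A)
    w k * K k m * psit n.+1 t k r / rsi_prob w K P (V n t) k - phi n.+1 m r)%R)%E.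

Lemma phi_error_selected n t : phi_error n.+1 t = selected_error n t (V n.+1 t).
Proof.
apply: eq_bigr => m _; congr (_ * _)%E; apply: eq_integral => r _.
congr ((_ * (_ - _) ^+ 2)%:E); apply: eq_bigr => k _.
by rewrite /rsi_p /= mulrAC.
Qed.

Let measurable_selected n t m (A : {set 'I_M}) : measurable_fun D (fun r => \sum_(k in A)
    w k * K k m * psit n.+1 t k r / rsi_prob w K P (V n t) k - phi n.+1 m r).
Proof.
apply: measurable_funB; last exact: measurable_phi.
apply: measurable_sum_cond => k; apply: measurable_funM => //.
by apply: measurable_funM => //; exact: measurable_psit.
Qed.

Let measurable_mean n t m :
  measurable_fun D (fun r => \sum_k w k * K k m * (psit n.+1 t k r - psi n.+1 k r)).
Proof.
apply: measurable_sum_cond => k; apply: measurable_funM => //.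
by apply: measurable_funB; [exact: measurable_psit|exact: measurable_psi].
Qed.

(** At each point of space this is [transversal_variance] for the terms
    [w k * K k m * psit n.+1 t k r], with the exact scattering term as [c]. *)
Lemma selected_energy_mean (m0 : 'I_M) n t m :
  (\sum_(A : {set 'I_M} | finset.is_transversal A P [set: 'I_M]%SET)
     (\prod_(k in A) rsi_prob w K P (V n t) k)%:E *
     en (fun r => \sum_(k in A)
       w k * K k m * psit n.+1 t k r / rsi_prob w K P (V n t) k - phi n.+1 m r)%R =
   sampling_variance n.+1 t m +
   en (fun r => \sum_k w k * K k m * (psit n.+1 t k r - psi n.+1 k r))%R)%E.
Proof.
rewrite -big_filter weighted_energy_sum//; last first.
  by move=> A; apply: prodr_ge0 => k _; exact/ltW/prob_gt0.
rewrite /sampling_variance leb3E -ge0_integralZl//; last 2 first.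
- exact: measurable_spread_density.
- by move=> r; exact: spread_density_ge0.
rewrite /energy leb3E -ge0_integralD//; last 4 first.
- by move=> r Dr; rewrite mule_ge0 ?lee_fin// -lee_fin spread_density_ge0.
- by apply: measurable_funeM; exact: measurable_spread_density.
- by move=> r /hSigT s0; rewrite lee_fin mulr_ge0 ?sqr_ge0// ltW.
- exact: measurable_energy_density.
apply: eq_integral => r _; rewrite -EFinM -EFinD; congr _%:E.
rewrite big_filter mulrCA -mulrDr; congr (_ * _).
rewrite (transversal_variance m0 (fun k => w k * K k m * psit n.+1 t k r) _ partP
  (prob_gt0 n t)); last by move=> g; apply: sum_rsi_prob => //; exact: (sel_transversal hV).
congr (_ + _ ^+ 2); rewrite /si_phi -sumrB; apply: eq_bigr => k _.
by rewrite -mulrBr.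
Qed.

(* Bias-variance decomposition over [V^(n+1)]: the conditional mean of the sampled
   scattering term is the exact one, and the exact scattering is a contraction. *)
Lemma mean_selected_error_le (m0 : 'I_M) n t :
  (\sum_(A : {set 'I_M} | finset.is_transversal A P [set: 'I_M]%SET)
     (\prod_(k in A) rsi_prob w K P (V n t) k)%:E * selected_error n t A <=
   \sum_m (w m)%:E * sampling_variance n.+1 t m + psi_error n.+1 t)%E.
Proof.
have w0 k : 0 <= w k by exact: ltW.
pose e (A : {set 'I_M}) m := en (fun r => \sum_(k in A)
  w k * K k m * psit n.+1 t k r / rsi_prob w K P (V n t) k - phi n.+1 m r)%R.
pose q (A : {set 'I_M}) := \prod_(k in A) rsi_prob w K P (V n t) k.
have q0 A : 0 <= q A by apply: prodr_ge0 => k _; exact/ltW/prob_gt0.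
have e0 A m : (0 <= e A m)%E by exact: energy_ge0.
have -> : (\sum_(A : {set 'I_M} | finset.is_transversal A P [set: 'I_M]%SET)
      (q A)%:E * selected_error n t A =
    \sum_m (w m)%:E * (sampling_variance n.+1 t m +
      en (fun r => \sum_k w k * K k m * (psit n.+1 t k r - psi n.+1 k r))%R))%E.
  transitivity (\sum_(A : {set 'I_M} | finset.is_transversal A P [set: 'I_M]%SET)
      \sum_m (w m)%:E * ((q A)%:E * e A m))%E.
    apply: eq_bigr => A _; rewrite /selected_error ge0_sume_distrr; last first.
      by move=> m _; rewrite mule_ge0 ?e0// lee_fin.
    by apply: eq_bigr => m _; rewrite muleCA.
  rewrite exchange_big/=; apply: eq_bigr => m _.
  rewrite -ge0_sume_distrr; last by move=> A _; rewrite mule_ge0 ?e0// lee_fin.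
  by rewrite -selected_energy_mean.
under eq_bigr do rewrite ge0_muleDr ?sampling_variance_ge0 ?energy_ge0//.
rewrite big_split/= leeD2l//.
rewrite /psi_error !weighted_energy_sum//; last first.
  by move=> k; apply: measurable_funB; [exact: measurable_psit|exact: measurable_psi].
apply: (@ge0_le_integral _ _ _ (@volume R)) => //.
- move=> r /hSigT s0; rewrite lee_fin mulr_ge0 ?(ltW s0)//.
  by apply: sumr_ge0 => k _; rewrite mulr_ge0 ?sqr_ge0.
- apply/measurable_EFinP; apply: measurable_funM => //.
  apply: measurable_sum_cond => k; apply: measurable_funM => //.
  exact: measurable_funX.
- apply/measurable_EFinP; apply: measurable_funM => //.
  apply: measurable_sum_cond => k; apply: measurable_funM => //.
  apply: measurable_funX.
  by apply: measurable_funB; [exact: measurable_psit|exact: measurable_psi].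
move=> r /hSigT s0; rewrite lee_fin ler_wpM2l ?(ltW s0)//.
by apply: scattering_contraction => // k m; exact: ltW.
Qed.

Lemma phi_variance_step n :
  (phi_variance D w K SigT P Pr V psi psit n.+1 <=
   psi_variance D w SigT Pr psi psit n.+1 + rsi_Mmax D w K SigT P Pr V psit)%E.
Proof.
have w0 k : 0 <= w k by exact: ltW.
(* Weights summing to 1 force an index to exist; it is the default value of the choice functions. *)
have [m0 _|I0] := pickP 'I_M; last first.
  by move: hw1; rewrite big_pred0// => /eqP; rewrite eq_sym oner_eq0.
have mS m := measurable_history_dep hV (fun t t' => @sampling_variance_history n t t' m).
have mpsi := measurable_history_dep hV (@psi_error_history n).
have msum : measurable_fun setT
    (fun t => \sum_m (w m)%:E * sampling_variance n.+1 t m)%E.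
  by apply: emeasurable_sum => m; exact: measurable_funeM.
have sum0 t : (0 <= \sum_m (w m)%:E * sampling_variance n.+1 t m)%E.
  by apply: sume_ge0 => m _; rewrite mule_ge0 ?sampling_variance_ge0// lee_fin.
have sel0 t A : (0 <= selected_error n t A)%E.
  by apply: sume_ge0 => m _; rewrite mule_ge0 ?energy_ge0// lee_fin.
have selH t t' A : history V n t = history V n t' ->
    selected_error n t A = selected_error n t' A.
  have aeF := ae_filter_ringOfSetsType (@volume R).
  move=> /history_eq Vtt'; apply: eq_bigr => m _; congr (_ * _)%E.
  apply: (energy_ae_eq mD mSigT) => //.
  have IHt k := @psit_history n.+1 t t' Vtt' k.
  move: (ae_forall_fin IHt); apply: filterS => r psiE Dr; congr (_ - _).
  by apply: eq_bigr => k _; rewrite psiE// Vtt'.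
rewrite phi_varianceE psi_varianceE.
under eq_integral do rewrite phi_error_selected.
rewrite (integral_selection hV sel0 selH); last by move=> t k; exact/ltW/prob_gt0.
apply: (@le_trans _ _ (\int[Pr]_t
    (\sum_m (w m)%:E * sampling_variance n.+1 t m + psi_error n.+1 t))%E).
  apply: ge0_le_integral => //.
  - move=> t _; apply: sume_ge0 => A _; rewrite mule_ge0// lee_fin.
    by apply: prodr_ge0 => k _; exact/ltW/prob_gt0.
  - apply: (measurable_history_dep hV (n := n)) => t t' tt'.
    apply: eq_bigr => A _; rewrite (selH _ _ _ tt').
    by have /history_eq/(_ n (leqnn n)) -> := tt'.
  - by apply: emeasurable_funD.
  - by move=> t _; exact: mean_selected_error_le.
rewrite ge0_integralD//; last by move=> t _; exact: psi_error_ge0.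
rewrite addeC leeD2l// ge0_integral_sum//; last 2 first.
- by move=> m; exact: measurable_funeM.
- by move=> m t _; rewrite mule_ge0 ?sampling_variance_ge0// lee_fin.
(* The weights sum to 1, so the weighted mean of the [rsi_M n.+1 m] is at most their supremum. *)
rewrite -[leRHS]mul1e -hw1 -sumEFin ge0_sume_distrl; last by move=> m _; rewrite lee_fin.
apply: lee_sum => m _; rewrite ge0_integralZl//; last 2 first.
- by move=> t _; exact: sampling_variance_ge0.
- by rewrite lee_fin.
rewrite lee_wpmul2l ?lee_fin//; apply: ereal_sup_ubound.
by exists n.+1, m.
Qed.

End VarianceRecursion.

(** * Solution of the recursion and uniform boundedness *)

Section VarianceBound.
Context {R : realType}.

(** Here [a] stands for the variances of the scattering terms and [b] for those of the fluxes. The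
    coefficients [k] are partial geometric sums, [k (i + 1) = rho^2 * k i + 1]; the bound for [b]
    holds with [rho^2 * k i], which is smaller by 1. *)
Lemma geometric_recursion (rho : R) (a b : nat -> \bar R) (m : \bar R) :
  0 <= rho -> rho < 1 -> (0 <= m)%E -> (forall n, 0 <= a n)%E ->
  (forall n, b n.+1 <= (rho ^+ 2)%:E * a n)%E -> (b 0%N <= a 0%N)%E ->
  (forall n, a n.+1 <= b n.+1 + m)%E ->
  forall n, let c := ((rho ^+ (2 * n))%:E * a 0%N +
    ((1 - rho ^+ (2 * n)) / (1 - rho ^+ 2))%:E * m)%E in (b n <= c)%E /\ (a n <= c)%E.
Proof.
move=> r0 r1 m0 a0 ba b0 ab n /=.
have r20 : 0 < 1 - rho ^+ 2 by rewrite subr_gt0 expr_lt1.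
pose k n : R := (1 - rho ^+ (2 * n)) / (1 - rho ^+ 2).
have k0 i : 0 <= k i.
  by rewrite divr_ge0 ?(ltW r20)// subr_ge0 exprn_ile1 // ltW.
have kS i : k i.+1 = rho ^+ 2 * k i + 1.
  by rewrite /k mulnS exprD; field; rewrite gt_eqF.
have step i : (a i <= (rho ^+ (2 * i))%:E * a 0%N + (k i)%:E * m)%E ->
    (b i.+1 <= (rho ^+ (2 * i.+1))%:E * a 0%N + (rho ^+ 2 * k i)%:E * m)%E.
  move=> ai; apply: (le_trans (ba i)).
  apply: (@le_trans _ _ ((rho ^+ 2)%:E *
      ((rho ^+ (2 * i))%:E * a 0%N + (k i)%:E * m))%E).
    by rewrite lee_wpmul2l// lee_fin sqr_ge0.
  rewrite ge0_muleDr; last 2 first.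
  - by rewrite mule_ge0 ?a0// lee_fin exprn_ge0.
  - by rewrite mule_ge0// lee_fin.
  by rewrite !muleA -!EFinM -exprD mulnS.
have main i : (a i <= (rho ^+ (2 * i))%:E * a 0%N + (k i)%:E * m)%E.
  elim: i => [|i IH].
    by rewrite muln0 expr0 mul1e /k expr0 subrr mul0r mul0e adde0.
  apply: (le_trans (ab i)).
  have rk0 : 0 <= rho ^+ 2 * k i by exact: mulr_ge0 (sqr_ge0 _) (k0 i).
  rewrite kS EFinD ge0_muleDl ?lee_fin//.
  by rewrite mul1e addeA leeD2r// step.
split; last exact: main.
case: n => [|i].
  by rewrite muln0 expr0 mul1e subrr mul0r mul0e adde0.
apply: (le_trans (step i (main i))); apply: leeD2l; apply: lee_wpmul2r => //.
by rewrite lee_fin -/(k i.+1) kS; rewrite lerDl ler01.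
Qed.

(** Induction with [(x + y)^2 <= (2 x)^2 + (2 y)^2], a generous constant since only finiteness is at
    stake. *)
Lemma energy_sum_fin (D : set (point3 R)) (sig : point3 R -> R) (I : Type)
    (s : seq I) (u : I -> point3 R -> R) :
  measurable (D : set (measurableTypeR R * measurableTypeR R * measurableTypeR R)%type) ->
  measurable_fun D sig -> (forall r, D r -> 0 < sig r) ->
  (forall i, measurable_fun D (u i)) -> (forall i, energy D sig (u i) < +oo)%E ->
  (energy D sig (fun r => \sum_(i <- s) u i r)%R < +oo)%E.
Proof.
move=> mD msig sig0 mu_ ufin; elim: s => [|i s IH].
  rewrite (_ : energy D sig _ = 0%E)// /energy.
  by apply: integral0_eq => r _; rewrite big_nil expr0n mulr0.
have ms : measurable_fun D (fun r => \sum_(i <- s) u i r) by exact: measurable_sum.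
apply: (@le_lt_trans _ _ (energy D sig (fun r => 2 * u i r)%R +
    energy D sig (fun r => 2 * \sum_(i <- s) u i r)%R)%E); last first.
  rewrite !energyZ// lte_add_pinfty// lte_mul_pinfty// ?lee_fin ?sqr_ge0//.
have m2 (v : point3 R -> R) : measurable_fun D v -> measurable_fun D (fun r => 2 * v r).
  by move=> mv; apply: measurable_funM.
have pos (v : point3 R -> R) r : D r -> (0 <= (sig r * v r ^+ 2)%:E)%E.
  by move=> /sig0 s0; rewrite lee_fin mulr_ge0 ?sqr_ge0// ltW.
rewrite /energy leb3E -ge0_integralD//; last 4 first.
- by move=> r; exact: (pos (fun r => 2 * u i r)).
- by apply: measurable_energy_density => //; exact: m2.
- by move=> r; exact: (pos (fun r => 2 * \sum_(i <- s) u i r)).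
- by apply: measurable_energy_density => //; exact: m2.
apply: ge0_le_integral => //.
- by move=> r; exact: (pos (fun r => \sum_(i <- i :: s) u i r)).
- by apply: measurable_energy_density => //; exact: measurable_sum.
- apply: emeasurable_funD; apply: measurable_energy_density => //; exact: m2.
move=> r Dr; rewrite -EFinD lee_fin -mulrDr ler_wpM2l ?(ltW (sig0 _ Dr))// big_cons.
move: (u i r) (\sum_(j <- s) _) => x y; rewrite -subr_ge0.
have -> : (2 * x) ^+ 2 + (2 * y) ^+ 2 - (x + y) ^+ 2 =
  2 * x ^+ 2 + 2 * y ^+ 2 + (x - y) ^+ 2 by ring.
have := sqr_ge0 x; have := sqr_ge0 y; have := sqr_ge0 (x - y); lra.
Qed.

End VarianceBound.
(** [bound n] is an extended real, possibly [+oo]. Uniform boundedness is therefore stated for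
    finite [Mmax], while finiteness of the initial variance is derived from [hpsi0]. *)
Theorem theorem2p2 (R : realType) (M : nat)
  (D : set (point3 R)) (nv : point3 R -> point3 R)
  (hD : bounded_convex_domain D) (hnv : outward_normal D nv)
  (Om : 'I_M -> point3 R) (w : 'I_M -> R) (K : 'I_M -> 'I_M -> R)
  (hOm : forall m, dot (Om m) (Om m) = 1)
  (hw1 : \sum_(m < M) w m = 1)
  (hKl : forall m, \sum_(k < M) w k * K k m = 1)
  (hKr : forall k, \sum_(m < M) w m * K k m = 1)
  (hw : forall k, 0 < w k) (hK : forall k m, 0 < K k m)
  (SigT SigS Q : point3 R -> R) (psiG : point3 R -> point3 R -> R)
  (mSigT : measurable_fun D SigT) (mSigS : measurable_fun D SigS)
  (hSigT : forall r, D r -> 0 < SigT r)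
  (hrho : (supnorm D (fun r => (SigS r / SigT r)%R) < 1)%E)
  (psi : nat -> 'I_M -> point3 R -> R)
  (mpsi0 : forall m, measurable_fun D (psi 0%N m))
  (hpsi0 : forall m,
    (l2norm D (fun r => (Num.sqrt (SigT r) * psi 0%N m r)%R) < +oo)%E)
  (hSI : source_iteration D nv Om w K SigT SigS Q psiG psi)
  (P : {set {set 'I_M}}) (hP : finset.partition P [set: 'I_M]%SET)
  (d : measure_display) (T : measurableType d) (Pr : probability T R)
  (V : nat -> T -> {set 'I_M})
  (hV : rsi_selection w K P Pr V)
  (psit : nat -> T -> 'I_M -> point3 R -> R)
  (hRSI : random_source_iteration D nv Om w K SigT SigS Q psiG P V
            (psi 0%N) psit) :
  let rho := fine (supnorm D (fun r => SigS r / SigT r)) in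
  let Mmax := rsi_Mmax D w K SigT P Pr V psit in
  let varpsi := psi_variance D w SigT Pr psi psit in
  let varphi := phi_variance D w K SigT P Pr V psi psit in
  let bound n := ((rho ^+ (2 * n))%:E * varphi 0%N +
    ((1 - rho ^+ (2 * n)) / (1 - rho ^+ 2))%:E * Mmax)%E in
  [/\ forall n t m, (1 <= n)%N -> 0 < rsi_p w K P V n t m,
      forall n, (varpsi n <= bound n)%E /\ (varphi n <= bound n)%E
    & (Mmax < +oo)%E ->
      exists C : R, forall n, (varpsi n <= C%:E)%E /\ (varphi n <= C%:E)%E].
Proof.
move=> rho Mmax varpsi varphi bound.
have D0 : D !=set0 by case: hD.
have [rho0 rho1 rhoP] := supnorm_ratio D0 hrho.
have oD : open D by case: hD.
have mD := open_measurable3 oD.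
have wpos k : 0 <= w k by exact: ltW.
have [m0 _|I0] := pickP 'I_M; last first.
  by move: hw1; rewrite big_pred0// => /eqP; rewrite eq_sym oner_eq0.
have varphi0 n : (0 <= varphi n)%E.
  by rewrite /varphi phi_varianceE//; apply: integral_ge0 => t _; exact: phi_error_ge0.
have rsi_M0 n m : (0 <= rsi_M D w K SigT P Pr V psit n m)%E.
  by apply: integral_ge0 => t _; exact: sampling_variance_ge0.
have Mmax0 : (0 <= Mmax)%E.
  apply: le_trans (rsi_M0 1%N m0) _; apply: ereal_sup_ubound.
  by exists 1%N, m0.
have psi_le n : (varpsi n.+1 <= (rho ^+ 2)%:E * varphi n)%E.
  exact: (psi_variance_step hD hnv hOm hw mSigT mSigS hSigT rhoP mpsi0 hSI hV hRSI).
have phi_le n : (varphi n.+1 <= varpsi n.+1 + Mmax)%E.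
  exact: (phi_variance_step hD hnv hOm hw1 hKl hKr hw hK mSigT mSigS hSigT rhoP
    mpsi0 hSI hV hRSI hP).
(* Both iterations start from the same functions, so the initial flux error is zero. *)
have psi0_le : (varpsi 0%N <= varphi 0%N)%E.
  apply: le_trans (varphi0 0%N); rewrite /varpsi psi_varianceE//.
  rewrite le_eqVlt; apply/orP; left; apply/eqP; apply: integral0_eq => t _.
  rewrite /psi_error big1// => m _; rewrite [energy _ _ _](_ : _ = 0%E) ?mule0//.
  by apply: integral0_eq => r _; rewrite (rsi_init hRSI) subrr expr0n mulr0.
have main := geometric_recursion rho0 rho1 Mmax0 varphi0 psi_le psi0_le phi_le.
split => //.
  move=> [//|n] t m _; apply: rsi_prob_gt0 => //; exact: (sel_transversal hV).
move=> Mfin.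
have phi0_error_fin t : (phi_error D w K SigT psi P V psit 0%N t < +oo)%E.
  have en_fin k : (energy D SigT (psi 0%N k) < +oo)%E.
    by rewrite -l2norm_sqr// expe2 lte_mul_pinfty// ?hpsi0 ?ge0_fin_numE ?sqrte_ge0.
  apply: lte_sum_pinfty => m _; apply: lte_mul_pinfty; rewrite ?lee_fin//.
  (* The initial error is a linear combination of the initial functions; [cf] is the sampled
     coefficient, zero off the selection, minus the exact one. *)
  pose cf k := (if k \in V 0%N t then w k * K k m * #|finset.pblock P k|%:R else 0) -
    w k * K k m.
  rewrite (_ : (fun r => _) = (fun r => \sum_(k < M) cf k * psi 0%N k r)).
    apply: energy_sum_fin => // k; first exact: measurable_funM.
    by rewrite energyZ// lte_mul_pinfty// lee_fin sqr_ge0.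
  apply/funext => r; rewrite /rsi_phi /si_phi [in LHS]big_mkcond -sumrB.
  apply: eq_bigr => k _; rewrite /cf mulrBl (rsi_init hRSI).
  by case: ifP => // _; rewrite mul0r.
(* The initial error is a function of the first selection, hence takes finitely many values, all
   finite. *)
have V0fin : (varphi 0%N < +oo)%E.
  have dep := phi_error_history hD hnv hOm mSigT mSigS hSigT rhoP mpsi0 hSI hRSI (n := 0%N).
  rewrite /varphi phi_varianceE// (factorE dep) integral_fin_valued.
  - apply: lte_sum_pinfty => h _; apply: lte_mul_pinfty.
    + by apply: factor_ge0 => t; exact: phi_error_ge0.
    + rewrite /factor; case: pselect => // e.
      by rewrite ge0_fin_numE ?phi0_error_fin// phi_error_ge0.
    + by rewrite (le_lt_trans (probability_le1 Pr _))// ?ltry//; exact: (measurable_history hV).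
  - exact: (measurable_history hV).
  - by move=> h; apply: factor_ge0 => t; exact: phi_error_ge0.
have r20 : 0 < 1 - rho ^+ 2 by rewrite subr_gt0 expr_lt1.
(* From [rho ^+ (2 * n) <= 1] in the first term and [1 - rho ^+ (2 * n) <= 1] in the second. *)
exists (fine (varphi 0%N) + (1 - rho ^+ 2)^-1 * fine Mmax) => n.
have le_C : (bound n <= (fine (varphi 0%N) + (1 - rho ^+ 2)^-1 * fine Mmax)%:E)%E.
  rewrite EFinD EFinM !fineK ?ge0_fin_numE// leeD//.
    by rewrite -[leRHS]mul1e lee_wpmul2r// lee_fin exprn_ile1// ltW.
  rewrite lee_wpmul2r// lee_fin ler_pdivrMr// mulVf ?gt_eqF//.
  by rewrite gerBl exprn_ge0.
by have [psin phin] := main n; split; [exact: le_trans psin le_C|exact: le_trans phin le_C].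
Qed.
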